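(* Let $P$ be a convex polytope in $\mathbb{R}^D$ with vertices in $\mathbb{Z}^D$, and let $s,d \in \mathbb{N}_0$ be given. Then the following are equivalent: (a) there exists a constant $c_{s,d} > 0$ such that, for all sufficiently large $n$, at least $c_{s,d}\cdot 2^{|L(nP)|}$ of the subsets $A \subset L(nP)$ satisfy $$|(L(nP)+L(nP)) \setminus (A+A)| = s \quad\text{and}\quad |(L(nP)-L(nP)) \setminus (A-A)| = 2d;$$ (b) $P$ is locally point symmetric.
   Context: For $S \subset \mathbb{R}^D$, $L(S) = S \cap \mathbb{Z}^D$ denotes the set of lattice points in $S$, and $nS$ denotes the dilation of $S$ by the factor $n$ about the origin. For finite sets $X,Y$, $X+Y=\{x+y: x\in X, y \in Y\}$ and $X-Y=\{x-y: x\in X,y\in Y\}$. Two vertices $\mathbf{u},\mathbf{v}$ of a convex polytope $P$ are strictly antipodal if there exist parallel supporting hyperplanes $H_1,H_2$ of $P$ with $H_1\cap P=\{\mathbf{u}\}$ and $H_2 \cap P = \{\mathbf{v}\}$. The supporting cone of $P$ at a vertex $\mathbf{v}$ is $C(\mathbf{v}) = \mathbf{v} + \bigcup_{\lambda \ge 0}\lambda(P - \mathbf{v})$. A convex polytope $P$ with $m$ vertices is locally point symmetric if its vertices can be partitioned into $m/2$ pairs of strictly antipodal vertices such that for each pair $\{\mathbf{u},\mathbf{v}\}$, $C(\mathbf{u}) - \mathbf{u} = \mathbf{v} - C(\mathbf{v})$.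
   Formalization: The polytope P is assumed to have at least two distinct points; for a single point with s = d = 0, (a) holds (take A = L(nP)) while its one vertex cannot be paired, so (b) fails. *)

(* Defs.v *)
From HB Require Import structures.
From mathcomp Require Import all_boot all_order all_algebra.
From mathcomp Require Import boolp reals.
From mathcomp Require Import finmap.

Set Implicit Arguments.
Unset Strict Implicit.
Unset Printing Implicit Defensive.

Import Order.TTheory GRing.Theory Num.Theory.
Local Open Scope ring_scope.

Section Geometry.
Variables (R : realType) (D : nat).

Definition dotp (a x : 'rV[R]_D) : R := \sum_(i < D) a ord0 i * x ord0 i.

Definition conv (S : seq 'rV[R]_D) (x : 'rV[R]_D) : Prop :=
  exists w : 'I_(size S) -> R,
    (forall i, 0 <= w i) /\ \sum_i w i = 1 /\ x = \sum_i w i *: S`_i.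

Definition intv (z : 'rV[int]_D) : 'rV[R]_D := map_mx (fun k : int => k%:~R) z.

Definition polytope (V : seq 'rV[int]_D) : 'rV[R]_D -> Prop := conv (map intv V).

Definition dilate (n : nat) (P : 'rV[R]_D -> Prop) (x : 'rV[R]_D) : Prop :=
  exists y, P y /\ x = n%:R *: y.

Definition supporting (P : 'rV[R]_D -> Prop) (a : 'rV[R]_D) (alpha : R) : Prop :=
  a != 0 /\
  ((forall x, P x -> dotp a x <= alpha) \/ (forall x, P x -> alpha <= dotp a x)) /\
  (exists x, P x /\ dotp a x = alpha).

Definition meets_only (P : 'rV[R]_D -> Prop) (a : 'rV[R]_D) (alpha : R) (v : 'rV[R]_D) : Prop :=
  forall x, (P x /\ dotp a x = alpha) <-> x = v.

Definition is_vertex (P : 'rV[R]_D -> Prop) (v : 'rV[R]_D) : Prop :=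
  exists a alpha, supporting P a alpha /\ meets_only P a alpha v.

Definition parallel (a1 a2 : 'rV[R]_D) : Prop :=
  exists lam : R, lam != 0 /\ a2 = lam *: a1.

Definition strictly_antipodal (P : 'rV[R]_D -> Prop) (u v : 'rV[R]_D) : Prop :=
  exists a1 alpha1 a2 alpha2,
    supporting P a1 alpha1 /\ supporting P a2 alpha2 /\ parallel a1 a2 /\
    meets_only P a1 alpha1 u /\ meets_only P a2 alpha2 v.

Definition supp_cone (P : 'rV[R]_D -> Prop) (v : 'rV[R]_D) (y : 'rV[R]_D) : Prop :=
  exists (lam : R) x, 0 <= lam /\ P x /\ y = v + lam *: (x - v).

Definition cone_symmetric (P : 'rV[R]_D -> Prop) (u v : 'rV[R]_D) : Prop :=
  forall z, (exists y, supp_cone P u y /\ z = y - u) <->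
            (exists y, supp_cone P v y /\ z = v - y).

(* The vertices are partitioned into pairs {v, sigma v} (sigma a fixed-point-free
   involution of the vertex set) of strictly antipodal vertices with
   C(u) - u = v - C(v). *)
Definition locally_point_symmetric (P : 'rV[R]_D -> Prop) : Prop :=
  exists sigma : 'rV[R]_D -> 'rV[R]_D,
    forall v, is_vertex P v ->
      [/\ is_vertex P (sigma v), sigma v != v, sigma (sigma v) = v,
          strictly_antipodal P v (sigma v) & cone_symmetric P v (sigma v)].

End Geometry.

Section Lattice.
Local Open Scope fset_scope.
Variables (R : realType) (D : nat).

Definition coord_bound (V : seq 'rV[int]_D) : nat :=
  \max_(v <- V) \max_(i < D) `|v ord0 i|%N.

Definition box (b : nat) : seq 'rV[int]_D :=
  [seq \row_i ((f i : nat)%:Z - b%:Z)%R | f : {ffun 'I_D -> 'I_(2 * b).+1}].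

(* L(nP) as a finite set; every lattice point of nP lies in the box of radius n*M *)
Definition Lpts (V : seq 'rV[int]_D) (n : nat) : {fset 'rV[int]_D} :=
  [fset z in box (n * coord_bound V) | `[< dilate n (@polytope R D V) (@intv R D z) >]].

Definition sumset (A B : {fset 'rV[int]_D}) : {fset 'rV[int]_D} :=
  [fset (x + y)%R | x in A, y in B].
Definition diffset (A B : {fset 'rV[int]_D}) : {fset 'rV[int]_D} :=
  [fset (x - y)%R | x in A, y in B].

Definition count_good (V : seq 'rV[int]_D) (s d n : nat) : nat :=
  let L := Lpts V n in
  #|` [fset A in fpowerset L |
        (#|` sumset L L `\` sumset A A | == s) &&
        (#|` diffset L L `\` diffset A A | == 2 * d)] |.

Definition property_a (V : seq 'rV[int]_D) (s d : nat) : Prop :=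
  exists c : R, 0 < c /\
    exists N : nat, forall n : nat, (N <= n)%N ->
      c * 2 ^+ #|` Lpts V n | <= (count_good V s d n)%:R.

End Lattice.

(* Main.v *)
(* Let v range over the vertices of P and K_v = cone (P - v).  A lattice point
   z = x + y of nP + nP, or z = x - y of nP - nP, has few representations only
   when it lies near a vertex: if x is far from v and y is far from the partner
   of v, then x and y can be moved simultaneously along an edge direction.  For
   sums the partner of v is v itself; for differences such a partner v' exists
   for each v exactly when K_v' = - K_v.

   If some linear form has a unique maximizer v on P but two minimizers w1, w2,
   then the n+1 differences n v - y, with y on the lattice path from n w1 to n w2,
   have a single representation each, and almost every A misses many of them.
   Hence (a) forces the minimizer to be unique too; it then depends only on v, and
   Farkas' lemma gives K_v' = - K_v.

   Conversely, the number of z with at most k representations is bounded by a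
   polynomial in k, uniformly in n, while a random A misses z with probability
   exponentially small in k.  So one may prescribe A near the vertices and the
   remaining sums and differences are all present with probability at least 1/2.
   Near all vertices A is taken full, except on an extreme ray at one vertex p and
   the opposite ray at its partner; an extreme ray being a face of the cone, this
   reduces to finding cofinite A0, B0 in N such that A0 + A0 and B0 + B0 miss s
   elements together and A0 + B0 misses d. *)

Require Import Defs.
From HB Require Import structures.
From mathcomp Require Import all_boot all_order all_algebra.
From mathcomp Require Import boolp reals.
From mathcomp Require Import finmap.
From mathcomp Require Import zify ring lra.

Set Implicit Arguments.
Unset Strict Implicit.
Unset Printing Implicit Defensive.

Import Order.TTheory GRing.Theory Num.Theory.
Local Open Scope ring_scope.

(** * The dot product and the Cauchy-Schwarz inequality *)

Section DotProduct.
Variables (R : realType) (D : nat).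
Implicit Types a x y : 'rV[R]_D.

Lemma dotpC x y : dotp x y = dotp y x.
Proof. by apply: eq_bigr => i _; rewrite mulrC. Qed.

Lemma dotpDr a x y : dotp a (x + y) = dotp a x + dotp a y.
Proof. by rewrite -big_split; apply: eq_bigr => i _; rewrite mxE mulrDr. Qed.

Lemma dotpZr k a x : dotp a (k *: x) = k * dotp a x.
Proof. by rewrite big_distrr; apply: eq_bigr => i _; rewrite mxE mulrCA. Qed.

Lemma dotpNr a x : dotp a (- x) = - dotp a x.
Proof. by rewrite -scaleN1r dotpZr mulN1r. Qed.

Lemma dotpBr a x y : dotp a (x - y) = dotp a x - dotp a y.
Proof. by rewrite dotpDr dotpNr. Qed.

Lemma dotp0r a : dotp a 0 = 0.
Proof. by rewrite -(scale0r 0) dotpZr mul0r. Qed.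

Lemma dotpDl a x y : dotp (x + y) a = dotp x a + dotp y a.
Proof. by rewrite dotpC dotpDr !(dotpC a). Qed.

Lemma dotpZl k a x : dotp (k *: x) a = k * dotp x a.
Proof. by rewrite dotpC dotpZr (dotpC a). Qed.

Lemma dotpNl a x : dotp (- x) a = - dotp x a.
Proof. by rewrite dotpC dotpNr (dotpC a). Qed.

Lemma dotpBl a x y : dotp (x - y) a = dotp x a - dotp y a.
Proof. by rewrite dotpDl dotpNl. Qed.

Lemma dotp0l a : dotp 0 a = 0.
Proof. by rewrite dotpC dotp0r. Qed.

Lemma dotp_sumr (I : finType) a (F : I -> 'rV[R]_D) :
  dotp a (\sum_i F i) = \sum_i dotp a (F i).
Proof. exact: (big_morph (dotp a) (dotpDr a) (dotp0r a)). Qed.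

Lemma dotpp_ge0 x : 0 <= dotp x x.
Proof. by apply: sumr_ge0 => i _; rewrite -expr2 sqr_ge0. Qed.

Lemma dotpp_eq0 x : dotp x x = 0 -> x = 0.
Proof.
move=> /eqP; rewrite psumr_eq0 => [/allP h|i _]; last by rewrite -expr2 sqr_ge0.
apply/rowP => i; rewrite mxE.
by have := h i (mem_index_enum _); rewrite /= mulf_eq0 orbb => /eqP.
Qed.

Lemma dotp_cauchy_schwarz x y : dotp x y ^+ 2 <= dotp x x * dotp y y.
Proof.
have [/eqP y0|y0] := boolP (dotp y y == 0).
  by rewrite (dotpp_eq0 y0) !dotp0r expr0n mulr0.
have yp : 0 < dotp y y by rewrite lt_def y0 dotpp_ge0.
(* The squared norm of this vector is y.y times the difference of the two sides of the claim. *)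
have := dotpp_ge0 (dotp y y *: x - dotp x y *: y).
rewrite !(dotpBl, dotpBr, dotpZl, dotpZr) (dotpC y x) => h.
rewrite -subr_ge0 -(pmulr_rge0 _ yp); apply: le_trans h _.
by rewrite le_eqVlt; apply/orP; left; apply/eqP; ring.
Qed.

End DotProduct.

(** * Farkas' lemma for finitely generated cones *)

Section Cones.
Variables (R : realType) (D : nat).
Implicit Types x y : 'rV[R]_D.

Definition conecomb m (g : 'I_m -> 'rV[R]_D) x :=
  exists c : 'I_m -> R, (forall i, 0 <= c i) /\ x = \sum_i c i *: g i.

(* Induction on the number of generators: when the functional b obtained for
   the first m generators is positive on the last one, project along the last
   generator onto the kernel of b. *)
Lemma farkas_nat m (g : nat -> 'rV[R]_D) y :
  (exists c : nat -> R, (forall i, 0 <= c i) /\ y = \sum_(i < m) c i *: g i) \/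
  (exists b, (forall i, (i < m)%N -> dotp b (g i) <= 0) /\ 0 < dotp b y).
Proof.
elim: m g y => [|m IH] g y.
  have [->|y0] := eqVneq y 0; first by left; exists (fun=> 0); rewrite big_ord0.
  right; exists y; split => //; rewrite lt_def dotpp_ge0 andbT.
  by apply: contra y0 => /eqP /dotpp_eq0 ->.
have [[c [c0 ->]]|[b [bg by0]]] := IH g y.
  left; exists (fun i => if i == m then 0 else c i); split.
    by move=> i; case: ifP.
  rewrite big_ord_recr /= eqxx scale0r addr0; apply: eq_bigr => i _.
  by rewrite ltn_eqF.
have [bm|bm] := lerP (dotp b (g m)) 0.
  right; exists b; split => // i; rewrite ltnS leq_eqVlt => /predU1P[->//|].
  exact: bg.
pose r x := dotp b x / dotp b (g m).
have [[c [c0 yE]]|[b' [bg' by0']]] := IH (fun i => g i - r (g i) *: g m) (y - r y *: g m).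
  (* The coefficient t of [g m] is nonnegative because r y > 0 while each r (g i) <= 0. *)
  left; pose t := r y - \sum_(i < m) c i * r (g i).
  exists (fun i => if i == m then t else c i); split.
    move=> i; case: ifP => // _; rewrite subr_ge0; apply: (@le_trans _ _ 0).
      apply: sumr_le0 => j _; rewrite mulr_ge0_le0 // /r.
      by rewrite pmulr_lle0 ?invr_gt0 // bg.
    by rewrite divr_ge0 // ltW.
  rewrite big_ord_recr /= eqxx.
  under eq_bigr => i _ do rewrite ltn_eqF //.
  move/eqP: yE; rewrite subr_eq => /eqP -> /=.
  under eq_bigr => i _ do rewrite scalerBr scalerA.
  by rewrite sumrB -scaler_suml /t scalerBl addrA addrAC.
(* [b2] is b' composed with the projection, so it vanishes on [g m]. *)
pose b2 := b' - (dotp b' (g m) / dotp b (g m)) *: b.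
have b2E x : dotp b2 x = dotp b' (x - r x *: g m).
  by rewrite dotpBl dotpZl dotpBr dotpZr /r; congr (_ - _); ring.
right; exists b2; split; last by rewrite b2E.
move=> i; rewrite ltnS leq_eqVlt => /predU1P[->|im]; last by rewrite b2E bg'.
by rewrite dotpBl dotpZl divfK ?subrr // gt_eqF.
Qed.

Lemma farkas m (g : 'I_m -> 'rV[R]_D) y :
  conecomb g y \/ exists b, (forall i, dotp b (g i) <= 0) /\ 0 < dotp b y.
Proof.
pose g' i := if insub i is Some j then g j else 0.
have g'E (i : 'I_m) : g' i = g i by rewrite /g' valK.
have [[c [c0 yE]]|[b [bg by0]]] := farkas_nat m g' y.
  left; exists (fun i => c i); split=> //; rewrite yE.
  by apply: eq_bigr => i _; rewrite g'E.
by right; exists b; split => // i; rewrite -g'E bg.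
Qed.

End Cones.

(** * Dilated hulls and the cones at their vertices *)

Section Affine.
Variables (R : realType) (D m : nat).
Implicit Types (v : 'I_m -> 'rV[R]_D) (x y : 'rV[R]_D).

(** For t > 0 this is the convex hull of v dilated by t. The dilation factor is the total weight, so
    points of nP can be moved by transferring weight between vertices. *)
Definition hull v (t : R) x := exists w : 'I_m -> R,
  [/\ forall i, 0 <= w i, \sum_i w i = t & x = \sum_i w i *: v i].

(** The supporting cone at [v j], moved to the origin. *)
Definition conic v (j : 'I_m) := conecomb (fun i => v i - v j).

Lemma conicD v j x y : conic v j x -> conic v j y -> conic v j (x + y).
Proof.
move=> [c [c0 ->]] [d [d0 ->]]; exists (fun i => c i + d i); split.
  by move=> i; rewrite addr_ge0.
by rewrite -big_split; apply: eq_bigr => i _; rewrite scalerDl.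
Qed.

Lemma conicZ v j k x : 0 <= k -> conic v j x -> conic v j (k *: x).
Proof.
move=> k0 [c [c0 ->]]; exists (fun i => k * c i); split.
  by move=> i; rewrite mulr_ge0.
by rewrite scaler_sumr; apply: eq_bigr => i _; rewrite scalerA.
Qed.

Lemma conic_gen v j i : conic v j (v i - v j).
Proof.
exists (fun l => (l == i)%:R); split; first by move=> l; rewrite ler0n.
rewrite (bigD1 i) //= eqxx scale1r big1 ?addr0 // => l /negPf ->.
by rewrite scale0r.
Qed.

Lemma conic0 v j : conic v j 0.
Proof. by rewrite -(subrr (v j)); exact: conic_gen. Qed.

Lemma weights_sub v j (w : 'I_m -> R) (t : R) :
  \sum_i w i = t -> \sum_i w i *: v i - t *: v j = \sum_i w i *: (v i - v j).
Proof.
move=> <-; rewrite scaler_suml -sumrB; apply: eq_bigr => i _.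
by rewrite scalerBr.
Qed.

Lemma hull_conic v t j x : hull v t x -> conic v j (x - t *: v j).
Proof. by move=> [w [w0 wt ->]]; exists w; rewrite weights_sub. Qed.

(** Each [v i] gains weight c i and [v j] pays for all of it. The hypothesis on [w j] says that it
    can afford to. *)
Lemma hull_shift v (w c : 'I_m -> R) j :
  (forall i, 0 <= w i) -> (forall i, 0 <= c i) -> \sum_i c i <= w j ->
  hull v (\sum_i w i) (\sum_i w i *: v i + \sum_i c i *: (v i - v j)).
Proof.
move=> w0 c0 cw; exists (fun i => w i + c i - (i == j)%:R * \sum_l c l).
have dj (f : 'I_m -> 'rV[R]_D) : \sum_i (i == j)%:R *: f i = f j.
  rewrite (bigD1 j) //= eqxx scale1r big1 ?addr0 // => l /negPf ->.
  by rewrite scale0r.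
split.
- move=> i; have [->|_] := eqVneq i j; last by rewrite mul0r subr0 addr_ge0.
  by rewrite mul1r addrAC addr_ge0 // subr_ge0.
- have d1 : \sum_i (i == j)%:R = 1 :> R.
    by rewrite (bigD1 j) //= eqxx big1 ?addr0 // => i /negPf ->.
  by rewrite sumrB big_split /= -mulr_suml d1 mul1r addrK.
under [RHS]eq_bigr => i _ do rewrite scalerBl scalerDl mulrC -scalerA.
rewrite sumrB big_split /= -scaler_sumr dj -addrA; congr (_ + _).
by rewrite weights_sub.
Qed.

Lemma hull_gen v t j : 0 <= t -> hull v t (t *: v j).
Proof.
move=> t0; exists (fun i => t * (i == j)%:R); split.
- by move=> i; rewrite mulr_ge0.
- rewrite (bigD1 j) //= eqxx mulr1 big1 ?addr0 // => i /negPf ->.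
  by rewrite mulr0.
rewrite (bigD1 j) //= eqxx mulr1 big1 ?addr0 // => i /negPf ->.
by rewrite mulr0 scale0r.
Qed.

Lemma hull_add_conic v t (c : 'I_m -> R) j :
  (forall i, 0 <= c i) -> \sum_i c i <= t ->
  hull v t (t *: v j + \sum_i c i *: (v i - v j)).
Proof.
move=> c0 ct; have t0 : 0 <= t by apply: le_trans ct; exact: sumr_ge0.
pose w i := t * (i == j)%:R.
have wS : \sum_i w i = t.
  rewrite (bigD1 j) //= /w eqxx mulr1 big1 ?addr0 // => i /negPf ->.
  by rewrite mulr0.
have -> : t *: v j = \sum_i w i *: v i.
  rewrite (bigD1 j) //= /w eqxx mulr1 big1 ?addr0 // => i /negPf ->.
  by rewrite mulr0 scale0r.
rewrite -wS; apply: hull_shift => //; last by rewrite /w eqxx mulr1.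
by move=> i; rewrite /w mulr_ge0.
Qed.

Lemma hull_le v (a : 'rV[R]_D) (al : R) t x :
  (forall i, dotp a (v i) <= al) -> hull v t x -> dotp a x <= t * al.
Proof.
move=> h [w [w0 <- ->]]; rewrite dotp_sumr mulr_suml; apply: ler_sum => i _.
by rewrite dotpZr ler_wpM2l.
Qed.

(** The deficits w i (a.v_j - a.v_i) are nonnegative and sum to zero, so all the weight sits at
    [v j]. *)
Lemma hull_face v (a : 'rV[R]_D) j t x :
  (forall i, i != j -> dotp a (v i) < dotp a (v j)) ->
  hull v t x -> dotp a x = t * dotp a (v j) -> x = t *: v j.
Proof.
move=> h [w [w0 <- ->]]; rewrite dotp_sumr mulr_suml => /eqP.
rewrite eq_sym -subr_eq0 -sumrB psumr_eq0 => [/allP z|i _]; last first.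
  have [->|ij] := eqVneq i j; first by rewrite dotpZr subrr.
  by rewrite dotpZr -mulrBr mulr_ge0 // subr_ge0 ltW // h.
rewrite scaler_suml; apply: eq_bigr => i _.
have [->//|ij] := eqVneq i j.
have := z i (mem_index_enum _); rewrite /= dotpZr -mulrBr mulf_eq0.
by rewrite subr_eq0 (gt_eqF (h _ ij)) orbF => /eqP ->; rewrite !scale0r.
Qed.

End Affine.

(** * Integer vectors inside real space *)

Section IntegerVectors.
Variables (R : realType) (D : nat).
Local Notation iv := (@intv R D).

Lemma intv_inj : injective iv.
Proof.
move=> x y /rowP e; apply/rowP => i; have := e i; rewrite !mxE => /eqP.
by rewrite eqr_int => /eqP.
Qed.

Lemma intvD x y : iv (x + y) = iv x + iv y.
Proof. by apply/rowP => i; rewrite !mxE intrD. Qed.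

Lemma intvN x : iv (- x) = - iv x.
Proof. by apply/rowP => i; rewrite !mxE intrN. Qed.

Lemma intvB x y : iv (x - y) = iv x - iv y.
Proof. by rewrite intvD intvN. Qed.

Lemma intvZ k x : iv (k *: x) = k%:~R *: iv x.
Proof. by apply/rowP => i; rewrite !mxE intrM. Qed.

Lemma intv0 : iv 0 = 0.
Proof. by apply/rowP => i; rewrite !mxE. Qed.

Lemma intvMn x n : iv (x *+ n) = n%:R *: iv x.
Proof.
elim: n => [|n IH]; first by rewrite mulr0n intv0 scale0r.
by rewrite mulrS intvD IH mulrS scalerDl scale1r.
Qed.


End IntegerVectors.

(** * Extracting the vertices of a lattice polytope *)

Section Polytopes.
Variables (R : realType) (D : nat).
Local Notation iv := (@intv R D).
Local Notation pt := (@polytope R D).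
Implicit Types (W : seq 'rV[int]_D).

Lemma hull_trans m m' (v : 'I_m -> 'rV[R]_D) (u : 'I_m' -> 'rV[R]_D) t x :
  (forall i, hull u 1 (v i)) -> hull v t x -> hull u t x.
Proof.
move=> h [w [w0 <- ->]].
have [d dP] := choice h.
exists (fun l => \sum_i w i * d i l); split.
- move=> l; apply: sumr_ge0 => i _; apply: mulr_ge0 => //.
  by have [d0 _ _] := dP i.
- rewrite exchange_big; apply: eq_bigr => i _; rewrite -mulr_sumr.
  by have [_ -> _] := dP i; rewrite mulr1.
under [RHS]eq_bigr => l _ do rewrite scaler_suml.
rewrite exchange_big; apply: eq_bigr => i _.
have [_ _ {1}->] := dP i; rewrite scaler_sumr; apply: eq_bigr => l _.
by rewrite scalerA.
Qed.

Definition seqpt W (i : 'I_(size W)) : 'rV[R]_D := iv W`_i.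

Lemma polytopeE W x : pt W x <-> hull (@seqpt W) 1 x.
Proof.
have e := size_map iv W.
have b1 : bijective (cast_ord e) by exact: (Bijective (cast_ordK _) (cast_ordKV _)).
have b2 : bijective (cast_ord (esym e)).
  exact: (Bijective (cast_ordKV _) (cast_ordK _)).
split=> [[w [w0 [w1 ->]]]|[w [w0 w1 ->]]].
  exists (fun i => w (cast_ord (esym e) i)); split => //.
    by rewrite -w1 [RHS](reindex _ (onW_bij _ b2)).
  rewrite (reindex _ (onW_bij _ b2)).
  by apply: eq_bigr => i _; rewrite (nth_map 0) /=.
exists (fun i => w (cast_ord e i)); split => //; split.
  by rewrite -w1 [RHS](reindex _ (onW_bij _ b1)).
rewrite (reindex _ (onW_bij _ b1)).
by apply: eq_bigr => i _; rewrite (nth_map 0) // -e.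
Qed.

Lemma polytope_mem W w : w \in W -> pt W (iv w).
Proof.
move=> wW; apply/polytopeE.
have lt : (index w W < size W)%N by rewrite index_mem.
have -> : iv w = 1 *: @seqpt W (Ordinal lt) by rewrite scale1r /seqpt /= nth_index.
exact: hull_gen.
Qed.

Lemma polytope_sub W W' x : (forall w, w \in W -> pt W' (iv w)) ->
  pt W x -> pt W' x.
Proof.
move=> h /polytopeE hx; apply/polytopeE; apply: hull_trans hx => i.
by apply/polytopeE; apply: h; rewrite mem_nth.
Qed.

(** Points lying in the hull of the remaining ones are discarded one at a time, by induction on the
    number of points. *)
Lemma irredundant_subseq W : exists W',
  [/\ uniq W', {subset W' <= W}, forall x : 'rV[R]_D, pt W x -> pt W' x &
      forall w, w \in W' -> ~ pt (rem w W') (iv w)].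
Proof.
have [n] := ubnP (size W); elim: n W => // n IH W; rewrite ltnS => sW.
have [[w [wW wP]]|no] :=
  pselect (exists w, w \in undup W /\ pt (rem w (undup W)) (iv w)); last first.
  exists (undup W); split.
  - exact: undup_uniq.
  - by move=> w; rewrite mem_undup.
  - by move=> x; apply: polytope_sub => w wW; apply: polytope_mem; rewrite mem_undup.
  - by move=> w wW wP; apply: no; exists w.
have sr : (size (rem w (undup W)) < n)%N.
  rewrite size_rem //; apply: leq_trans sW.
  by rewrite (leq_trans _ (size_undup W)) // prednK // -has_predT; apply/hasP; exists w.
have [W' [uW' sW' hW' iW']] := IH _ sr.
exists W'; split => //.
  by move=> x /sW' /mem_rem; rewrite mem_undup.
move=> x xW; apply: hW'; apply: polytope_sub xW => u uW.
have [->//|uw] := eqVneq u w.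
apply: polytope_mem; rewrite mem_rem_uniq ?undup_uniq //.
by rewrite inE /= uw mem_undup.
Qed.

(** Farkas' lemma one dimension higher: with all points lifted to height 1, a conic combination
    giving y has total weight 1, hence is convex. Otherwise the last coordinate of the separating
    functional contributes the same constant on both sides and cancels. *)
Lemma strict_separation W y : ~ pt W y ->
  exists a : 'rV[R]_D, forall w, w \in W -> dotp a (iv w) < dotp a y.
Proof.
move=> yW; pose lift (x : 'rV[R]_D) : 'rV[R]_(D + 1) := row_mx x 1%:M.
have [[c [c0 e]]|[b [bg by0]]] := farkas (fun i => lift (@seqpt W i)) (lift y).
  case: yW; apply/polytopeE; exists c; split => //.
    have := congr1 (fun z : 'rV_(D + 1) => rsubmx z 0 0) e.
    rewrite row_mxKr mxE /= linear_sum summxE => e1; apply: etrans (esym e1).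
    by apply: eq_bigr => i _; rewrite linearZ /= row_mxKr !mxE mulr1.
  have := congr1 (fun z : 'rV_(D + 1) => lsubmx z) e.
  rewrite row_mxKl /= => ->; rewrite linear_sum.
  by apply: eq_bigr => i _; rewrite linearZ /= row_mxKl.
have bE x : dotp b (lift x) = dotp (lsubmx b) x + b 0 (rshift D ord0).
  rewrite /dotp big_split_ord /= big_ord1; congr (_ + _).
    by apply: eq_bigr => i _; rewrite row_mxEl mxE.
  by rewrite row_mxEr mxE mulr1.
exists (lsubmx b) => w wW; rewrite -(ltrD2r (b 0 (rshift D ord0))) -!bE.
apply: le_lt_trans by0.
have lt : (index w W < size W)%N by rewrite index_mem.
by have := bg (Ordinal lt); rewrite /seqpt /= nth_index.
Qed.

(** In an irredundant generating family each point is outside the hull of the others, and separating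
    it from them exposes it. Two distinct points of P force at least two generators. *)
Lemma polytope_vertex_system (V : seq 'rV[int]_D) :
  (exists v1 v2, v1 \in V /\ v2 \in V /\ v1 != v2) ->
  exists m (v : 'I_m -> 'rV[int]_D),
   [/\ injective v, (1 < m)%N,
       forall x, pt V x <-> hull (fun i => iv (v i)) 1 x &
       forall j, exists a : 'rV[R]_D,
         forall i, i != j -> dotp a (iv (v i)) < dotp a (iv (v j))].
Proof.
move=> [v1 [v2 [v1V [v2V v12]]]].
have [W [uW sW hW iW]] := irredundant_subseq V.
exists (size W), (fun i => W`_i); split.
- by move=> i j /eqP; rewrite nth_uniq // => /eqP /val_inj.
- have := hW _ (polytope_mem v1V); have := hW _ (polytope_mem v2V).
  case: {sW hW iW uW} W => [|w [|]] //.
    by move=> /polytopeE [c [_ /eqP]]; rewrite big_ord0 eq_sym oner_eq0.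
  move=> /polytopeE [c [_]]; rewrite !big_ord1 => -> e2.
  move=> /polytopeE [c' [_]]; rewrite !big_ord1 => -> e1.
  by move: v12; rewrite (intv_inj (etrans e1 (esym e2))) eqxx.
- move=> x; split=> [/hW /polytopeE //|hx].
  have /polytope_sub : forall w, w \in W -> pt V (iv w).
    by move=> w /sW; apply: polytope_mem.
  by apply; apply/polytopeE.
- move=> j; have jW : W`_j \in W by rewrite mem_nth.
  have [a aP] := strict_separation (iW _ jW).
  exists a => i ij; apply: aP; rewrite mem_rem_uniq // inE /= mem_nth // andbT.
  by rewrite nth_uniq.
Qed.

End Polytopes.

(** * Lattice points of dilates *)

Section LatticePoints.
Variables (R : realType) (D : nat).
Local Notation iv := (@intv R D).
Local Notation pt := (@polytope R D).

Lemma mem_box b (z : 'rV[int]_D) :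
  reflect (forall i, (`|z ord0 i| <= b)%N) (z \in box D b).
Proof.
apply: (iffP imageP) => [[f _ ->] i|h].
  rewrite mxE; move: (nat_of_ord _) (ltn_ord (f i)) => k; lia.
exists [ffun i => inord (absz (z ord0 i + b%:Z))] => //; apply/rowP => i.
rewrite mxE ffunE; have := h i; rewrite !ord1; move: (z _ _) => k hk; rewrite inordK; lia.
Qed.

Lemma size_box b : size (box D b) = ((2 * b).+1 ^ D)%N.
Proof. by rewrite size_map -cardE card_ffun !card_ord. Qed.

(** A convex combination of points of V has coordinates bounded by [coord_bound V], so every lattice
    point of nP lies in the box. *)
Lemma mem_Lpts V n z : (z \in Lpts R V n) <-> dilate n (pt V) (iv z).
Proof.
rewrite !inE; split=> [/andP[_ /asboolP]//|h]; apply/andP; split; last exact/asboolP.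
apply/mem_box => i; case: h => y [/polytopeE [w [w0 w1 yE]] zE].
have e : (z ord0 i)%:~R = n%:R * \sum_j w j * (seqpt R j ord0 i).
  have := congr1 (fun x : 'rV_D => x ord0 i) zE; rewrite !mxE yE => ->.
  by rewrite summxE; congr (_ * _); apply: eq_bigr => j _; rewrite mxE.
rewrite -(ler_nat R) natrM natr_absz intr_norm e normrM normr_nat ler_wpM2l //.
apply: le_trans (ler_norm_sum _ _ _) _.
rewrite -[leRHS]mul1r -[X in _ <= X * _]w1 mulr_suml; apply: ler_sum => j _.
rewrite normrM (ger0_norm (w0 j)) ler_wpM2l // /seqpt mxE -intr_norm -natr_absz.
rewrite ler_nat /coord_bound.
rewrite (big_nth 0) big_mkord; apply: leq_trans (leq_bigmax j).
exact: (leq_bigmax i).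
Qed.

Lemma dilate_hull m (v : 'I_m -> 'rV[R]_D) P n x : (0 < n)%N ->
  (forall y, P y <-> hull v 1 y) -> (dilate n P x <-> hull v n%:R x).
Proof.
move=> n0 PE; have n0' : n%:R != 0 :> R by rewrite pnatr_eq0 -lt0n.
split=> [[y [/PE [w [w0 w1 ->]] ->]]|[w [w0 wn ->]]].
  exists (fun i => n%:R * w i); split; first by move=> i; rewrite mulr_ge0.
    by rewrite -mulr_sumr w1 mulr1.
  by rewrite scaler_sumr; apply: eq_bigr => i _; rewrite scalerA.
exists (n%:R^-1 *: \sum_i w i *: v i); split; last by rewrite scalerA divff ?scale1r.
apply/PE; exists (fun i => n%:R^-1 * w i); split.
- by move=> i; rewrite mulr_ge0 // invr_ge0.
- by rewrite -mulr_sumr wn mulVf.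
by rewrite scaler_sumr; apply: eq_bigr => i _; rewrite scalerA.
Qed.

Lemma mulrn_vec_inj (x : 'rV[int]_D) : x != 0 -> injective (fun n => x *+ n).
Proof.
move=> x0 a b e.
have [i xi] : exists i, x ord0 i != 0.
  apply/existsP; apply: contraNT x0 => /existsPn h; apply/eqP/rowP => i.
  by have := h i; rewrite negbK mxE => /eqP.
have := congr1 (fun y : 'rV_D => y ord0 i) e; rewrite !mulmxnE.
exact: mulrIn.
Qed.

End LatticePoints.

(** * Counting families of finite sets *)

Section FiniteSets.
Local Open Scope fset_scope.

Lemma card_fset_union_bound (K : choiceType) (T : eqType) (r : seq T)
    (G : {fset K}) (F : T -> {fset K}) :
  (forall x, x \in G -> exists2 i, i \in r & x \in F i) ->
  (#|` G| <= \sum_(i <- r) #|` F i|)%N.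
Proof.
elim: r G => [|i r IH] G h.
  rewrite big_nil leqn0 cardfs_eq0; apply/eqP/fsetP => x; rewrite inE.
  by apply/negP => /h [].
rewrite big_cons -(cardfsID (F i) G) leq_add //.
  by rewrite fsubset_leq_card // fsubsetIr.
apply: IH => x; rewrite !inE => /andP[xi /h [k]].
by rewrite inE => /predU1P[->|kr] xk; [rewrite xk in xi|exists k].
Qed.

Lemma card_fsetU_le (K : choiceType) (A B : {fset K}) :
  (#|` A `|` B| <= #|` A| + #|` B|)%N.
Proof. by rewrite cardfsU leq_subr. Qed.

(** A uniformly random subset of L contains B with probability 2^-|B|: removing B maps the supersets
    injectively to subsets of the complement of B in L. *)
Lemma card_supersets (K : choiceType) (L B : {fset K}) : B `<=` L ->
  (#|` [fset A in fpowerset L | B `<=` A]| * 2 ^ #|` B| <= 2 ^ #|` L|)%N.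
Proof.
move=> BL; rewrite -(cardfsID B L) (fsetIidPr BL) expnD mulnC leq_mul2l.
apply/orP; right; rewrite -card_fpowerset.
have inj : {in [fset A in fpowerset L | B `<=` A] &, injective (fun A => A `\` B)}.
  move=> A A'; rewrite !inE => /andP[_ AB] /andP[_ A'B] e.
  by rewrite -(fsetID B A) -(fsetID B A') e (fsetIidPr AB) (fsetIidPr A'B).
rewrite -(card_in_imfset imfset_key inj) fsubset_leq_card //; apply/fsubsetP => X.
move=> /imfsetP [A /=]; rewrite !inE fpowersetE => /andP[AL _] ->.
by rewrite fpowersetE fsetSD.
Qed.

End FiniteSets.

(** * Two minimizers opposite a unique maximizer contradict (a) *)

Section NecessityCount.
Local Open Scope fset_scope.
Local Open Scope ring_scope.
Variables (R : realType) (D m : nat) (V : seq 'rV[int]_D) (v : 'I_m -> 'rV[int]_D).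
Local Notation iv := (@intv R D).
Local Notation rv := (fun i => iv (v i)).
Hypothesis hV : forall x, @polytope R D V x <-> hull rv 1 x.

Lemma mem_Lpts_hull n z : (0 < n)%N -> (z \in Lpts R V n) <-> hull rv n%:R (iv z).
Proof. by move=> n0; rewrite mem_Lpts; apply: dilate_hull. Qed.

Lemma diffsetP (A B : {fset 'rV[int]_D}) z :
  reflect (exists x y, [/\ x \in A, y \in B & z = x - y]) (z \in diffset A B).
Proof.
apply: (iffP idP) => [/imfset2P [x /= xA [y /= yB ->]]|[x [y [xA yB ->]]]].
  by exists x, y.
by apply/imfset2P; exists x => //; exists y.
Qed.

(** The form a takes its largest value on nP - nP at [v j *+ n - y]. Attaining it forces x to be the
    vertex [v j *+ n], and then y' = y. *)
Lemma unique_diff_rep n (a : 'rV[R]_D) j k (x y y' : 'rV[int]_D) : (0 < n)%N ->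
  (forall i, i != j -> dotp a (rv i) < dotp a (rv j)) ->
  (forall i, dotp a (rv k) <= dotp a (rv i)) ->
  dotp a (iv y) = n%:R * dotp a (rv k) ->
  x \in Lpts R V n -> y' \in Lpts R V n -> v j *+ n - y = x - y' -> y' = y.
Proof.
move=> n0 aj ak ya /(mem_Lpts_hull _ n0) hx /(mem_Lpts_hull _ n0) hy' e.
have /= hx' := @hull_le _ _ _ rv a (dotp a (rv j)) n%:R (iv x).
have xle : dotp a (iv x) <= n%:R * dotp a (rv j).
  by apply: hx' => // i; have [->//|/aj/ltW] := eqVneq i j.
have yge : dotp (- a) (iv y') <= n%:R * dotp (- a) (rv k).
  by apply: hull_le hy' => i; rewrite !dotpNl lerN2.
have e' : n%:R *: rv j - iv y = iv x - iv y'.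
  by rewrite -intvMn -!intvB e.
have := congr1 (dotp a) e'; rewrite !dotpBr dotpZr ya => ea.
have xE : iv x = n%:R *: rv j.
  apply: (hull_face aj hx); apply/eqP; rewrite eq_le xle /=.
  move: yge; rewrite !dotpNl; lra.
by apply: (@intv_inj R); move: e'; rewrite xE => /addrI /oppr_inj.
Qed.

(** Cut the lattice path from n v_k1 to n v_k2 into 2d + 1 blocks of length l. If A contains no
    whole block, each block yields a difference that A misses, which is more than 2d in total. So a
    good A contains one of the blocks, and the proportion of such A is at most (2d + 1) / 2^l <
    c. *)
Lemma not_property_a s d (a : 'rV[R]_D) j k1 k2 :
  injective v -> k1 != k2 ->
  (forall i, i != j -> dotp a (rv i) < dotp a (rv j)) ->
  (forall i, dotp a (rv k1) <= dotp a (rv i)) ->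
  dotp a (rv k2) = dotp a (rv k1) ->
  ~ property_a R V s d.
Proof.
move=> vi k12 aj ak1 ak2 [c [c0 [N hN]]].
pose q := (2 * d)%N.
have [l hl] : exists l : nat, q.+1%:R < c * 2 ^+ l :> R.
  exists (Num.bound (q.+1%:R / c)).
  rewrite mulrC -ltr_pdivrMr //.
  have := @archi_boundP _ (q.+1%:R / c) (divr_ge0 (ler0n _ _) (ltW c0)).
  move/lt_trans; apply; rewrite -natrX ltr_nat; exact: ltn_expl.
(* Beyond the threshold N, positive, and large enough for the path to hold all blocks. *)
pose n := maxn N.+1 (q.+1 * l).
have Nn : (N <= n)%N by rewrite /n; lia.
have n0 : (0 < n)%N by rewrite /n; lia.
have ln : (q.+1 * l <= n)%N by rewrite /n; lia.
pose L := Lpts R V n.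
pose y t := v k1 *+ n + (v k2 - v k1) *+ t.
have yinj : injective y.
  move=> t t' /addrI; apply: mulrn_vec_inj; rewrite subr_eq0.
  by apply: contraNN k12 => /eqP /vi ->.
have yE t : iv (y t) = n%:R *: rv k1 + t%:R *: (rv k2 - rv k1).
  by rewrite intvD !intvMn intvB.
have yL t : (t <= n)%N -> y t \in L.
  move=> tn; apply/mem_Lpts_hull => //; rewrite yE.
  have -> : t%:R *: (rv k2 - rv k1) =
      \sum_i (t%:R * (i == k2)%:R) *: (rv i - rv k1).
    rewrite (bigD1 k2) //= eqxx mulr1 big1 ?addr0 // => i /negPf ->.
    by rewrite mulr0 scale0r.
  apply: hull_add_conic => [i|]; first by rewrite mulr_ge0.
  rewrite (bigD1 k2) //= eqxx mulr1 big1 ?addr0 ?ler_nat // => i /negPf ->.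
  by rewrite mulr0.
have ya t : dotp a (iv (y t)) = n%:R * dotp a (rv k1).
  by rewrite yE dotpDr !dotpZr dotpBr ak2 subrr mulr0 addr0.
pose B i := [fset y (i * l + r)%N | r in iota 0 l].
pose G := [fset A in fpowerset L | (#|` sumset L L `\` sumset A A | == s) &&
        (#|` diffset L L `\` diffset A A | == 2 * d)%N].
have tn i r : (i < q.+1)%N -> (r < l)%N -> (i * l + r <= n)%N.
  by move=> iq rl; apply: leq_trans ln; nia.
have BL i : (i < q.+1)%N -> B i `<=` L.
  move=> iq; apply/fsubsetP => x /imfsetP [r /=]; rewrite mem_iota => rl ->.
  by apply: yL; exact: tn.
have BC i : #|` B i| = l.
  rewrite card_imfset /= ?size_iota //; last first.
    by move=> r r' /yinj /addnI.
  by rewrite undup_id ?iota_uniq // size_iota.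
have hG A : A \in G -> exists2 i, i \in iota 0 q.+1 &
    A \in [fset A in fpowerset L | B i `<=` A].
  rewrite !inE fpowersetE => /andP[AL /andP[_ /eqP Aq]].
  have [[i [iq iB]]|no] := pselect (exists i, (i < q.+1)%N /\ B i `<=` A).
    by exists i; rewrite ?mem_iota // !inE fpowersetE AL.
  (* One path point outside A is picked from each block. *)
  have h (i : 'I_q.+1) : exists r : nat, (r < l)%N /\ y (i * l + r)%N \notin A.
    have /fsubsetPn [x /imfsetP [r /=]] : ~~ (B i `<=` A).
      by apply/negP => h; apply: no; exists i.
    by rewrite mem_iota => rl -> xA; exists r.
  have [r rP] := choice h.
  pose z (i : 'I_q.+1) := v j *+ n - y (i * l + r i)%N.
  have zinj : injective z.
    move=> i i' /addrI /oppr_inj /yinj e; apply: val_inj => /=.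
    have [rl _] := rP i; have [rl' _] := rP i'.
    by have := congr1 (fun u => u %/ l)%N e;
       rewrite !divnMDl ?divn_small ?addn0 // (leq_ltn_trans _ rl).
  have sub : [fset z i | i : 'I_q.+1] `<=` diffset L L `\` diffset A A.
    apply/fsubsetP => x /imfsetP [i _ ->]; have [rl yA] := rP i.
    rewrite inE; apply/andP; split.
      apply/negP => /diffsetP [x1 [x2 [x1A x2A e]]].
      have := @unique_diff_rep n a j k1 x1 _ x2 n0 aj ak1 (ya _)
         (fsubsetP AL _ x1A) (fsubsetP AL _ x2A) e.
      by move=> x2E; rewrite -x2E x2A in yA.
    apply/diffsetP; exists (v j *+ n), (y (i * l + r i)%N); split => //.
      apply/mem_Lpts_hull => //; rewrite intvMn.
      exact: (@hull_gen _ _ _ rv n%:R j (ler0n _ _)).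
    by apply: yL; exact: tn.
  have := fsubset_leq_card sub.
  by rewrite Aq card_imfset //= -cardE card_ord ltnn.
have cG := card_fset_union_bound hG.
have cB i : i \in iota 0 q.+1 ->
    (#|` [fset A in fpowerset L | B i `<=` A]| * 2 ^ l <= 2 ^ #|` L|)%N.
  by rewrite mem_iota => /BL h; have := card_supersets h; rewrite BC.
have : (#|` G| * 2 ^ l <= q.+1 * 2 ^ #|` L|)%N.
  apply: leq_trans (_ : \sum_(i <- iota 0 q.+1) 2 ^ #|` L| <= _)%N; last first.
    by rewrite big_const_seq iter_addn_0 count_predT size_iota mulnC.
  apply: leq_trans (leq_mul cG (leqnn _)) _.
  by rewrite big_distrl /= big_seq [leqRHS]big_seq; apply: leq_sum.
apply/negP; rewrite -ltnNge -(ltr_nat R) !natrM !natrX.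
apply: lt_le_trans (_ : c * 2 ^+ #|`L| * 2 ^+ l <= _).
  by rewrite mulrAC ltr_pM2r // exprn_gt0.
by rewrite ler_wpM2r ?exprn_ge0 //; exact: hN.
Qed.

End NecessityCount.

(** * Vertices and supporting cones in terms of the exposed family *)

Section VertexSystem.
Variables (R : realType) (D m : nat) (P : 'rV[R]_D -> Prop) (v : 'I_m -> 'rV[R]_D).
Hypothesis hP : forall x, P x <-> hull v 1 x.

(** Such a form, for distinct points, lies in the open normal cone at [v j]. *)
Definition exposes (a : 'rV[R]_D) j := forall i, i != j -> dotp a (v i) < dotp a (v j).

Hypothesis m1 : (1 < m)%N.

Lemma exists_other (j : 'I_m) : exists i, i != j.
Proof.
case: m m1 j => [|[|n]] // _ j.
by have [->|j0] := eqVneq j ord0; [exists (lift ord0 ord0)|exists ord0; rewrite eq_sym].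
Qed.

Lemma exposes_neq0 a j : exposes a j -> a != 0.
Proof.
move=> h; have [i ij] := exists_other j; apply/eqP => a0.
by have := h i ij; rewrite a0 !dotp0l ltxx.
Qed.

Lemma vertex_mem j : P (v j).
Proof. by apply/hP; rewrite -[v j]scale1r; exact: hull_gen. Qed.

Lemma exposes_max a j x : exposes a j -> P x -> dotp a x <= dotp a (v j).
Proof.
move=> h /hP /hull_le -/(_ a (dotp a (v j))); rewrite mul1r; apply => i.
by have [->//|/h/ltW] := eqVneq i j.
Qed.

Lemma exposes_meets_only a j : exposes a j -> meets_only P a (dotp a (v j)) (v j).
Proof.
move=> h x; split=> [[/hP hx e]|->]; last by split => //; exact: vertex_mem.
by rewrite -[v j]scale1r; apply: (hull_face h hx); rewrite mul1r.
Qed.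

Lemma exposes_supporting a j : exposes a j -> supporting P a (dotp a (v j)).
Proof.
move=> h; split; first exact: exposes_neq0 h.
split; first by left => x; exact: exposes_max.
by exists (v j); split => //; exact: vertex_mem.
Qed.

(** Any [v j] of nonzero weight in x must itself attain the maximum, so it equals x by
    uniqueness. *)
Lemma meets_only_vertex a al x : (forall y, P y -> dotp a y <= al) ->
  meets_only P a al x -> exists j, x = v j.
Proof.
move=> hle hx; have [/hP [w [w0 w1 xE]] ax] := (hx x).2 erefl.
have [j wj] : exists j, w j != 0.
  apply/existsP; apply: contraPT w1 => /existsPn h.
  rewrite big1 => [/eqP|i _]; first by rewrite eq_sym oner_eq0.
  by apply/eqP; rewrite -[_ == _]negbK h.
exists j; apply/esym/hx; split; first exact: vertex_mem.
have : \sum_i w i * (al - dotp a (v i)) == 0.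
  under eq_bigr => i _ do rewrite mulrBr -dotpZr.
  by rewrite sumrB -mulr_suml w1 mul1r -dotp_sumr -xE ax subrr.
rewrite psumr_eq0 => [/allP /(_ j (mem_index_enum _)) /=|i _]; last first.
  by rewrite mulr_ge0 // subr_ge0 hle //; exact: vertex_mem.
by rewrite mulf_eq0 (negPf wj) subr_eq0 => /eqP.
Qed.

(** A supporting hyperplane may bound P from either side; the lower case reduces to the upper one by
    negating the form. *)
Lemma is_vertexP : (forall j, exists a, exposes a j) ->
  forall x, is_vertex P x <-> exists j, x = v j.
Proof.
move=> hexp x; split=> [[a [al [[_ [h _]] hx]]]|[j ->]]; last first.
  have [a ha] := hexp j; exists a, (dotp a (v j)); split.
    exact: exposes_supporting.
  exact: exposes_meets_only.
case: h => h; first exact: meets_only_vertex h hx.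
apply: (@meets_only_vertex (- a) (- al)).
  by move=> y /h; rewrite dotpNl lerN2.
move=> y; rewrite -hx dotpNl; split=> -[? e]; split => //.
  exact: oppr_inj.
by rewrite e.
Qed.

Lemma supp_coneP j y : supp_cone P (v j) y <-> conic v j (y - v j).
Proof.
split=> [[lam [x [lam0 [/hP hx ->]]]]|[c [c0 e]]].
  rewrite addrC addKr; apply: conicZ => //.
  by have := hull_conic j hx; rewrite scale1r.
(* Dividing by S brings the point into P; the summand 1 keeps S positive when all c i vanish. *)
pose S := 1 + \sum_i c i.
have Sc : \sum_i c i <= S by rewrite lerDr.
have S0 : 0 < S by rewrite ltr_pwDl // sumr_ge0.
exists S, (v j + S^-1 *: (y - v j)); split; first exact: ltW.
split; last by rewrite [_ + _ - _]addrC addKr scalerA divff ?gt_eqF // scale1r addrC subrK.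
apply/hP; rewrite e scaler_sumr -{1}[v j]scale1r.
under eq_bigr => i _ do rewrite scalerA.
apply: hull_add_conic => [i|]; first by rewrite mulr_ge0 // invr_ge0 ltW.
by rewrite -mulr_sumr mulrC ler_pdivrMr // mul1r.
Qed.

Lemma cone_symmetricP j k :
  cone_symmetric P (v j) (v k) <-> forall z, conic v j z <-> conic v k (- z).
Proof.
have ex1 i z : (exists y, supp_cone P (v i) y /\ z = y - v i) <-> conic v i z.
  split=> [[y [/supp_coneP h ->]]//|h]; exists (z + v i); rewrite addrK.
  by split => //; apply/supp_coneP; rewrite addrK.
have ex2 i z : (exists y, supp_cone P (v i) y /\ z = v i - y) <-> conic v i (- z).
  rewrite -ex1; split=> -[y [h e]]; exists y; split => //.
    by rewrite e opprB.
  by rewrite -[z]opprK e opprB.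
by split=> h z; have := h z; rewrite ex1 ex2.
Qed.

End VertexSystem.

(** * Opposite vertices, when every unique maximizer comes with a unique minimizer *)

Section OppositeVertices.
Variables (R : realType) (D m : nat) (v : 'I_m -> 'rV[R]_D).

Hypothesis opposite_exposed :
  forall a j, exposes v a j -> exists k, exposes v (- a) k.

(** Strict antipodality of [v j] and [v k], witnessed by a single linear form. *)
Definition opposite j k := exists a, exposes v a j /\ exposes v (- a) k.

Lemma opposite_sym j k : opposite j k -> opposite k j.
Proof. by move=> [a [aj ak]]; exists (- a); rewrite opprK. Qed.

(* Moving from a1 towards a2 inside the open normal cone of v j, the minimizer
   would have to change, and at the first change there are two minimizers. *)
Lemma opposite_inj j k1 k2 : opposite j k1 -> opposite j k2 -> k1 = k2.
Proof.
move=> [a1 [a1j a1k]] [a2 [a2j a2k]]; apply/eqP/negPn/negP => k12.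
pose al i := dotp a1 (v i - v k1); pose be i := dotp a2 (v i - v k1).
have al0 i : i != k1 -> 0 < al i.
  by move=> /a1k; rewrite !dotpNl ltrN2 /al dotpBr subr_gt0.
have be2 : be k2 < 0 by have := a2k k1 k12; rewrite !dotpNl ltrN2 /be dotpBr subr_lt0.
(* Under a1 + t a2 the vertex [v i] ties with [v k1] at t = [t i]. Only the i with be i < 0 ever
   catch up. *)
pose t i := al i / - be i.
pose l := [arg min_(i < k2 | be i < 0) t i]%O.
have [lb lmin] : be l < 0 /\ forall i, be i < 0 -> t l <= t i.
  by rewrite /l; case: arg_minP.
have lk1 : l != k1.
  by apply/eqP => e; move: lb; rewrite /be e subrr dotp0r ltxx.
have tl0 : 0 < t l by rewrite divr_gt0 ?oppr_gt0 // al0.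
pose a := a1 + t l *: a2.
have aj : exposes v a j.
  move=> i ij; rewrite !dotpDl !dotpZl ltrD ?a1j //.
  by rewrite ltr_pM2l // a2j.
have amin i : dotp a (v k1) <= dotp a (v i).
  rewrite -subr_ge0 -dotpBr dotpDl dotpZl -/(al i) -/(be i).
  have [->|ik1] := eqVneq i k1; first by rewrite /al /be subrr !dotp0r mulr0 addr0.
  have [b0|b0] := ltP (be i) 0; last first.
    by apply: addr_ge0; [exact: ltW (al0 _ ik1)|apply: mulr_ge0 => //; exact: ltW].
  have := lmin i b0; rewrite {2}/t ler_pdivlMr ?oppr_gt0 //.
  by rewrite mulrN -subr_ge0 opprK.
have al1 : dotp a (v l) = dotp a (v k1).
  apply/eqP; rewrite -subr_eq0 -dotpBr dotpDl dotpZl -/(al l) -/(be l).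
  by rewrite /t invrN mulrN mulNr divfK ?subrr // lt_eqF.
have [k ak] := opposite_exposed aj.
have [e|kk1] := eqVneq k1 k.
  by have := ak l; rewrite -e => /(_ lk1); rewrite !dotpNl ltrN2 al1 ltxx.
have := ak k1 kk1; rewrite !dotpNl ltrN2 => h.
by have := amin k; rewrite leNgt h.
Qed.

(** If -z were outside the cone at [v k], Farkas gives b <= 0 on that cone with b.z < 0. A small
    multiple of a form exposing k makes b expose k while staying negative at z. By uniqueness the
    opposite of k is j, so the perturbed form is minimal at [v j] and hence nonnegative on the cone
    at [v j], which contains z. *)
Lemma opposite_conic j k z : opposite j k -> conic v j z -> conic v k (- z).
Proof.
move=> jk jz.
have [//|[b [bk bz]]] := farkas (fun i => v i - v k) (- z).
have [a0 [a0k _]] := opposite_sym jk.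
(* With this [ep] the perturbation changes the value at z by less than half of |b.z|. *)
pose g := dotp a0 z; pose ep := - dotp b z / (2 * (`|g| + 1)).
have bz0 : dotp b z < 0 by rewrite -oppr_gt0 -dotpNr.
have g1 : 0 < `|g| + 1 by rewrite ltr_wpDl.
have ep0 : 0 < ep by rewrite divr_gt0 ?oppr_gt0 // mulr_gt0.
pose a := b + ep *: a0.
have ak : exposes v a k.
  move=> i ik; rewrite -subr_gt0 -dotpBr dotpDl dotpZl.
  have := bk i; have := a0k i ik; rewrite -subr_gt0 -dotpBr => h1.
  rewrite -oppr_ge0 -dotpNr opprB => h2.
  by apply: ltr_wpDl => //; rewrite mulr_gt0.
have [k' ak'] := opposite_exposed ak.
have k'j : k' = j by apply: (@opposite_inj k); [exists a|exact: opposite_sym].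
rewrite k'j in ak'.
have az : 0 <= dotp a z.
  have [c [c0 ->]] := jz; rewrite dotp_sumr; apply: sumr_ge0 => i _.
  rewrite dotpZr mulr_ge0 // dotpBr subr_ge0.
  by have [->//|/ak'] := eqVneq i j; rewrite !dotpNl ltrN2 => /ltW.
have : dotp a z < 0.
  rewrite dotpDl dotpZl -/g; apply: (@le_lt_trans _ _ (dotp b z + ep * `|g|)).
    by rewrite lerD2l ler_wpM2l ?ler_norm // ltW.
  have -> : dotp b z = - (ep * (2 * (`|g| + 1))).
    by rewrite /ep divfK ?opprK // gt_eqF // mulr_gt0.
  rewrite addrC subr_lt0 ltr_pM2l //; have := normr_ge0 g; lra.
by rewrite ltNge az.
Qed.

End OppositeVertices.

Lemma opposite_exposed_symmetric (R : realType) (D m : nat)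
    (P : 'rV[R]_D -> Prop) (v : 'I_m -> 'rV[R]_D) :
  (1 < m)%N -> injective v -> (forall x, P x <-> hull v 1 x) ->
  (forall j, exists a, exposes v a j) ->
  (forall a j, exposes v a j -> exists k, exposes v (- a) k) ->
  locally_point_symmetric P.
Proof.
move=> m1 vi hP hexp hopp.
have hop j : exists k, opposite v j k.
  by have [a aj] := hexp j; have [k ak] := hopp a j aj; exists k, a.
have [tau tauP] := choice hop.
(* [sigma] has to be total; it is the identity away from the vertices. *)
pose sigma x := if [pick j | x == v j] is Some j then v (tau j) else x.
have sE j : sigma (v j) = v (tau j).
  rewrite /sigma; case: pickP => [i /eqP /vi -> //|/(_ j)].
  by rewrite eqxx.
have tauK j : tau (tau j) = j.
  by apply: (opposite_inj hopp (tauP (tau j))); apply: opposite_sym.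
exists sigma => x /(is_vertexP hP m1 hexp) [j ->]; rewrite !sE tauK.
have [a [aj ak]] := tauP j.
split => //.
- by apply/(is_vertexP hP m1 hexp); exists (tau j).
- have [i ij] := exists_other m1 j; apply/eqP => /vi e; rewrite e in ak.
  by have := ak i ij; have := aj i ij; rewrite !dotpNl; lra.
- exists a, (dotp a (v j)), (- a), (dotp (- a) (v (tau j))); split.
    exact: exposes_supporting aj.
  split; first exact: exposes_supporting ak.
  split; first by exists (-1); rewrite oppr_eq0 oner_eq0 scaleN1r.
  by split; exact: exposes_meets_only.
apply/cone_symmetricP => // z; split; first exact: opposite_conic (tauP j).
move=> /(opposite_conic hopp (opposite_sym (tauP j))).
by rewrite opprK.
Qed.

(** A second minimizer of a form exposing [v j] would contradict [not_property_a]. *)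
Lemma property_a_symmetric (R : realType) (D m : nat) (V : seq 'rV[int]_D)
    (v : 'I_m -> 'rV[int]_D) s d :
  (1 < m)%N -> injective v ->
  (forall x : 'rV[R]_D, polytope V x <-> hull (fun i => intv R (v i)) 1 x) ->
  (forall j, exists a : 'rV[R]_D, exposes (fun i => intv R (v i)) a j) ->
  property_a R V s d -> locally_point_symmetric (@polytope R D V).
Proof.
move=> m1 vi hV hexp pa.
apply: (opposite_exposed_symmetric m1 _ hV) => //.
  by move=> i j /intv_inj /vi.
move=> a j aj.
pose k := [arg min_(i < j) dotp a (intv R (v i))]%O.
have kmin i : dotp a (intv R (v k)) <= dotp a (intv R (v i)).
  by rewrite /k; case: arg_minP => // l _; apply.
exists k => i ik; rewrite !dotpNl ltrN2 lt_neqAle kmin andbT.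
apply/eqP => e; apply: (@not_property_a R D m V v hV s d a j k i) => //.
by rewrite eq_sym.
Qed.

(** * Sets of natural numbers with prescribed numbers of gaps *)

Section OneDimension.

Definition nsum (A B : pred nat) t := [exists i : 'I_t.+1, A i && B (t - i)%N].

Lemma nsumP (A B : pred nat) t :
  reflect (exists i j, [/\ A i, B j & (i + j)%N = t]) (nsum A B t).
Proof.
apply: (iffP existsP) => [[i /andP[Ai Bi]]|[i [j [Ai Bj <-]]]].
  by exists i, (t - i)%N; split => //; rewrite subnKC // -ltnS.
have lt : (i < (i + j).+1)%N by rewrite ltnS leq_addr.
by exists (Ordinal lt); rewrite /= Ai addKn Bj.
Qed.

(** When 0 is in A and every t >= T is in B, this counts all gaps of A + B. *)
Definition missing (A B : pred nat) T := count (fun t => ~~ nsum A B t) (iota 0 T).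

Lemma missing_interval (A B : pred nat) T lo hi : (lo <= hi <= T)%N ->
  (forall t, (t < lo)%N || (hi <= t)%N ->
    exists i j, [/\ A i, B j & (i + j)%N = t]) ->
  (forall i j, A i -> B j -> (lo <= i + j < hi)%N -> False) ->
  missing A B T = (hi - lo)%N.
Proof.
move=> /andP[lohi hiT] h1 h2.
rewrite /missing -size_filter -(size_iota lo (hi - lo)).
congr size; apply: (@sorted_eq _ ltn ltn_trans).
- by move=> x y; lia.
- by rewrite sorted_filter ?iota_ltn_sorted //; exact: ltn_trans.
- exact: iota_ltn_sorted.
apply: uniq_perm; rewrite ?filter_uniq ?iota_uniq // => t.
rewrite mem_filter !mem_iota /= subnKC //.
apply/andP/andP => [[tAB tT]|[lt th]].
  apply/andP; apply: contraR tAB => tlh; apply/nsumP/h1; lia.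
split; last by lia.
by apply/nsumP => -[i [j [Ai Bj e]]]; apply: (h2 i j Ai Bj); rewrite e lt.
Qed.

(* If s > 2d, take {0} u (a, oo) with a = s - d for A and a = d for B.
   Otherwise every t <= 2h is a sum of two elements of the common
   part [0,2d] u [4d+1,h], and an element of the window [2h+1,2h+d] is a sum
   only through one of the isolated points a = 2h+1-(3d+1), b = 2h+1-(2d+1)
   together with an element of [3d+1,4d] (kept by A only) resp. [2d+1,3d] (kept
   by B only). *)
Lemma exists_fringe_pair (s d : nat) : exists T (A B : pred nat),
  [/\ A 0%N /\ B 0%N, forall t, (T <= t)%N -> A t /\ B t,
      (missing A A T + missing B B T)%N = s & missing A B T = d].
Proof.
have [sd|ds] := leqP s (2 * d); last first.
  pose u := (s - d)%N.
  pose Z a t := (t == 0)%N || (a < t)%N.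
  have Zm a b : (a <= b)%N -> (b <= u)%N -> missing (Z b) (Z a) u.+1 = a.
    move=> ab bu; rewrite -[RHS](subn1 a.+1); apply: missing_interval.
    - lia.
    - by move=> t ht; exists 0%N, t; split => //; rewrite /Z; lia.
    - by move=> x y; rewrite /Z; lia.
  have du : (d <= u)%N by rewrite /u; lia.
  exists u.+1, (Z u), (Z d); split => //.
  - by move=> t h; split; apply/orP; right; lia.
  - by rewrite !Zm // /u; lia.
  - by rewrite Zm.
(* A + A is to miss j elements and B + B the other k; s <= 2d makes both at most d. *)
pose j := minn s d; pose k := (s - j)%N; pose h := (6 * d + 1)%N.
have jd : (j <= d)%N by rewrite /j; lia.
have kd : (k <= d)%N by rewrite /k /j; lia.
have jk : (j + k)%N = s by rewrite /k /j; lia.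
pose G t := (t <= 2 * d)%N || (4 * d < t <= h)%N.
pose A t := [|| G t, (3 * d + 1 + j <= t <= 4 * d)%N, t == (9 * d + 2)%N
               | (2 * h + d < t)%N].
pose B t := [|| G t, (2 * d + 1 + k <= t <= 3 * d)%N, t == (10 * d + 2)%N
               | (2 * h + d < t)%N].
clearbody j k.
have GG t : (t <= 2 * h)%N -> exists i j, [/\ G i, G j & (i + j)%N = t].
  rewrite /G /h => th.
  (* The four ranges come from [0,2d] + [0,2d], then [0,h] and h + [0,2d], then 4d+1 and finally h,
     each of the last two added to [4d+1,h]. *)
  have [h1|h1] := leqP t (4 * d).
    by exists (minn t (2 * d)), (t - minn t (2 * d))%N; split; lia.
  have [h2|h2] := leqP t (8 * d + 1).
    by exists (minn t (6 * d + 1)), (t - minn t (6 * d + 1))%N; split; lia.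
  have [h3|h3] := leqP (10 * d + 2) t.
    by exists (6 * d + 1)%N, (t - (6 * d + 1))%N; split; lia.
  by exists (4 * d + 1)%N, (t - (4 * d + 1))%N; split; lia.
have GA t : G t -> A t by rewrite /A => ->.
have GB t : G t -> B t by rewrite /B => ->.
have A0 : A 0%N by [].
have B0 : B 0%N by [].
have AA : missing A A (2 * h + d).+1 = j.
  rewrite -[RHS](addKn (2 * h + 1)); apply: missing_interval.
  - lia.
  - move=> t; have [th _|th /= ht] := leqP t (2 * h).
      by have [x [y [/GA Gx /GA Gy xy]]] := GG t th; exists x, y.
    have [tl|tl] := leqP t (2 * h + d); last first.
      by exists 0%N, t; split => //; rewrite /A tl !orbT.
    exists (9 * d + 2)%N, (t - (9 * d + 2))%N; split.
    + by rewrite /A eqxx !orbT.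
    + by rewrite /A /G; move: ht tl th; rewrite /h; lia.
    + by move: th; rewrite /h; lia.
  - by move=> x y; rewrite /A /G /h; lia.
have BB : missing B B (2 * h + d).+1 = k.
  rewrite -[RHS](addKn (2 * h + 1)); apply: missing_interval.
  - lia.
  - move=> t; have [th _|th /= ht] := leqP t (2 * h).
      by have [x [y [/GB Gx /GB Gy xy]]] := GG t th; exists x, y.
    have [tl|tl] := leqP t (2 * h + d); last first.
      by exists 0%N, t; split => //; rewrite /B tl !orbT.
    exists (10 * d + 2)%N, (t - (10 * d + 2))%N; split.
    + by rewrite /B eqxx !orbT.
    + by rewrite /B /G; move: ht tl th; rewrite /h; lia.
    + by move: th; rewrite /h; lia.
  - by move=> x y; rewrite /B /G /h; lia.
have AB : missing A B (2 * h + d).+1 = d.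
  rewrite -[RHS](addKn (2 * h + 1)); apply: missing_interval.
  - lia.
  - move=> t; have [th _|th /= ht] := leqP t (2 * h).
      by have [x [y [/GA Gx /GB Gy xy]]] := GG t th; exists x, y.
    by exists 0%N, t; split => //; rewrite /B (_ : (2 * h + d < t)%N) ?orbT //; lia.
  - by move=> x y; rewrite /A /B /G /h; lia.
exists (2 * h + d).+1, A, B; split => //.
- by move=> t ht; rewrite /A /B ht !orbT.
- by rewrite AA BB.
Qed.

End OneDimension.

(** * A polynomial times a geometric sequence has small tails *)

Section Tail.
Variable R : realType.

(** Write j = iQ + r with r < Q. Then j + 1 <= Q(i + 1), and the Q-th power of (i + 1)(3/4)^i <= 3
    gives the bound. *)
Lemma poly_le_exp Q j : (j.+1 ^ Q * 3 ^ j <= (3 * Q) ^ Q * 4 ^ j)%N.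
Proof.
have bern i : (i.+1 * 3 ^ i <= 3 * 4 ^ i)%N.
  (* With i + 3 in place of i + 1 the induction closes, as 3(i + 4) <= 4(i + 3). *)
  suff : ((i + 3) * 3 ^ i <= 3 * 4 ^ i)%N.
    by apply: leq_trans; rewrite leq_mul2r; lia.
  by elim: i => // i IH; rewrite !expnS; nia.
case: Q => [|Q]; first by rewrite !mul1n; elim: j => // j IH; rewrite !expnS leq_mul.
pose i := (j %/ Q.+1)%N.
have jE : j = (i * Q.+1 + j %% Q.+1)%N by exact: divn_eq.
have jr : (j %% Q.+1 < Q.+1)%N by rewrite ltn_mod.
have ji : (j.+1 <= Q.+1 * i.+1)%N by move: jr; rewrite {2}jE; nia.
have h1 : (i.+1 ^ Q.+1 * 3 ^ (i * Q.+1) <= 3 ^ Q.+1 * 4 ^ (i * Q.+1))%N.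
  by rewrite !expnM -!expnMn leq_exp2r.
have h2 r : (3 ^ r <= 4 ^ r)%N by elim: r => // r IH; rewrite !expnS leq_mul.
have h3 : (j.+1 ^ Q.+1 <= Q.+1 ^ Q.+1 * i.+1 ^ Q.+1)%N by rewrite -expnMn leq_exp2r.
rewrite [in (3 ^ j)%N]jE [in (4 ^ j)%N]jE !expnD expnMn.
apply: leq_trans (leq_mul h3 (leqnn _)) _.
apply: leq_trans (_ : Q.+1 ^ Q.+1 * ((i.+1 ^ Q.+1 * 3 ^ (i * Q.+1)) * 3 ^ (j %% Q.+1)) <= _)%N.
  by rewrite !mulnA.
apply: leq_trans (leq_mul (leqnn (Q.+1 ^ Q.+1)%N) (leq_mul h1 (h2 (j %% Q.+1)%N))) _.
by rewrite !mulnA leq_mul2r leq_mul2r (mulnC (3 ^ _)%N) leqnn !orbT.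
Qed.

(** This will bound the expected number of missed z with more than k0 representations. Using
    exponent q + 2 in [poly_le_exp] leaves a factor 1/(k+1)^2 <= 1/k - 1/(k+1), which telescopes to
    at most E/k0. *)
Lemma geometric_tail (C q c0 : nat) : exists k0 : nat, forall K,
  \sum_(k0 <= k < K) (C * k.+1 ^ q)%:R * (3 / 4) ^+ ((k - c0) %/ 3) <= 4^-1 :> R.
Proof.
pose Q := q.+2; pose C2 := ((c0 + 3) ^ Q * (3 * Q) ^ Q)%N.
have bound k : (k.+1 ^ Q * 3 ^ ((k - c0) %/ 3) <= C2 * 4 ^ ((k - c0) %/ 3))%N.
  set j := ((k - c0) %/ 3)%N.
  have kj : (k.+1 <= (c0 + 3) * j.+1)%N.
    have := divn_eq (k - c0) 3; rewrite -/j; have := @ltn_mod (k - c0) 3; nia.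
  apply: leq_trans (_ : ((c0 + 3) ^ Q * (j.+1 ^ Q * 3 ^ j)) <= _)%N.
    by rewrite mulnA -expnMn leq_mul2r leq_exp2r // kj orbT.
  by rewrite /C2 -mulnA leq_mul2l poly_le_exp orbT.
clearbody C2.
pose E := (C * C2)%N; pose k0 := (4 * E).+1.
have term k : (0 < k)%N -> (C * k.+1 ^ q)%:R * (3 / 4) ^+ ((k - c0) %/ 3)
     <= E%:R * (k%:R^-1 - k.+1%:R^-1) :> R.
  move=> k1; have := bound k; set j := ((k - c0) %/ 3)%N => b.
  have k0' : 0 < k%:R :> R by rewrite ltr0n.
  have k1' : 0 < k.+1%:R :> R by rewrite ltr0n.
  rewrite /E !natrM -!mulrA ler_wpM2l //.
  apply: le_trans (_ : C2%:R / k.+1%:R ^+ 2 <= _).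
    rewrite ler_pdivlMr ?exprn_gt0 // mulrAC natrX -exprD addnC.
    rewrite expr_div_n mulrA ler_pdivrMr ?exprn_gt0 //.
    by rewrite -!natrX -!natrM ler_nat -/Q.
  rewrite ler_wpM2l //.
  have -> : k%:R^-1 - k.+1%:R^-1 = (k%:R * k.+1%:R)^-1 :> R.
    rewrite -[k.+1]addn1 natrD in k1' *; field.
    by rewrite !gt_eqF.
  rewrite lef_pV2 ?posrE ?mulr_gt0 ?exprn_gt0 // expr2.
  by rewrite ler_wpM2r ?ler_nat.
exists k0 => K.
have [Kk0|k0K] := leqP K k0; first by rewrite big_geq // invr_ge0.
apply: le_trans (_ : \sum_(k0 <= k < K) E%:R * (k%:R^-1 - k.+1%:R^-1) <= _).
  rewrite big_nat [leRHS]big_nat; apply: ler_sum => k /andP[k0k _].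
  by apply: term; apply: leq_trans k0k.
rewrite -mulr_sumr.
have -> : \sum_(k0 <= k < K) (k%:R^-1 - k.+1%:R^-1) = k0%:R^-1 - K%:R^-1 :> R.
  have := telescope_sumr (fun k => - k%:R^-1 : R) (ltnW k0K).
  rewrite opprK [RHS]addrC => <-.
  by apply: eq_bigr => k _; rewrite opprK addrC.
apply: le_trans (_ : E%:R / k0%:R <= _).
  by rewrite ler_wpM2l // gerBl invr_ge0.
have : 4 * E%:R <= k0%:R :> R by rewrite -natrM ler_nat /k0.
by rewrite ler_pdivrMr ?ltr0n //; lra.
Qed.

End Tail.

(** * Random sets that complete no pair *)

Section AvoidingPairs.
Local Open Scope fset_scope.
Variables (K : choiceType) (phi : K -> K).
Hypothesis phi_inj : injective phi.
Implicit Types (A E U X : {fset K}).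

(** With x and [phi x] the two summands of some z, this says that A together with the forced set E
    does not represent z through X. *)
Definition avoids E X A :=
  all (fun x => ~~ ((x \in A `|` E) && (phi x \in A `|` E))) (enum_fset X).

Lemma avoidsP E X A : reflect
  (forall x, x \in X -> ~~ ((x \in A `|` E) && (phi x \in A `|` E))) (avoids E X A).
Proof. exact: (iffP allP). Qed.

(** Pairs {x, phi x} are chosen greedily and disjointly. Each choice spoils at most three elements
    of X: x, its image and its only preimage. On each pair at most 3/4 of the traces of A are
    allowed. *)
Lemma card_avoids E U X p : (3 * p <= #|` X|)%N ->
  (forall x, x \in X -> (x \in U `|` E) && (phi x \in U `|` E)) ->
  (#|` [fset A in fpowerset U | avoids E X A]| * 4 ^ p <= 3 ^ p * 2 ^ #|` U|)%N.
Proof.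
elim: p U X => [|p IH] U X pX XU.
  rewrite muln1 mul1n -card_fpowerset fsubset_leq_card //.
  by apply/fsubsetP => A; rewrite !inE => /andP[].
have /fset0Pn [x xX] : X != fset0 by rewrite -cardfs_gt0; lia.
pose X' := [fset y in X | [&& y != x, y != phi x & phi y != x]].
pose W := [fset y in X | phi y == x].
(* The undecided part of the pair. If it is empty, the whole pair lies in E and no A avoids it,
   matching 2^0 - 1 = 0. *)
pose D := U `&` [fset x; phi x].
have cD : (#|` D| <= 2)%N.
  apply: leq_trans (fsubset_leq_card (fsubsetIr _ _)) _.
  by rewrite cardfs2; case: eqP.
have cW : (#|` W| <= 1)%N.
  have [->|/fset0Pn [y]] := eqVneq W fset0; first by rewrite cardfs0.
  rewrite !inE => /andP[_ /eqP yx]; rewrite -(cardfs1 y) fsubset_leq_card //.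
  apply/fsubsetP => z; rewrite !inE -yx => /andP[_ /eqP /phi_inj ->] //.
have pX' : (3 * p <= #|` X'|)%N.
  have sub : X `<=` X' `|` ([fset x; phi x] `|` W).
    apply/fsubsetP => y yX; rewrite !inE yX /=.
    by do 3!case: eqP => //=.
  have := fsubset_leq_card sub; rewrite cardfsU.
  have := cardfsU [fset x; phi x] W; have : (#|` [fset x; phi x]| <= 2)%N.
    by rewrite cardfs2; case: eqP.
  lia.
have X'U y : y \in X' -> (y \in (U `\` D) `|` E) && (phi y \in (U `\` D) `|` E).
  rewrite !inE => /and4P[yX y1 y2 y3]; have := XU y yX; rewrite !inE.
  have y4 : phi y != phi x by rewrite (inj_eq phi_inj).
  by rewrite (negPf y1) (negPf y2) (negPf y3) (negPf y4) !andbF.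
pose F := [fset A in fpowerset U | avoids E X A].
pose F' := [fset A in fpowerset (U `\` D) | avoids E X' A].
(* The trace D itself is forbidden, since it would complete the pair. *)
have hF : (#|` F| <= #|` F'| * (2 ^ #|` D| - 1))%N.
  rewrite -card_fpowerset; have <- : #|` fpowerset D `\ D| = (#|` fpowerset D| - 1)%N.
    by rewrite (cardfsD1 D (fpowerset D)) fpowersetE fsubset_refl add1n subn1.
  pose Z := fpowerset D `\ D.
  have slice B : (#|` [fset A in F | A `&` D == B]| <= #|` F'|)%N.
    have inj : {in [fset A in F | A `&` D == B] &, injective (fun A => A `\` D)}.
      move=> A A'; rewrite !inE => /andP[_ /eqP e] /andP[_ /eqP e'] e2.
      by rewrite -(fsetID D A) -(fsetID D A') e e' e2.
    rewrite -(card_in_imfset imfset_key inj) fsubset_leq_card //.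
    apply/fsubsetP => _ /imfsetP [A /= + ->].
    rewrite !inE !fpowersetE => /andP[/andP[AU /avoidsP av] _].
    rewrite fsetSD //=; apply/avoidsP => y; rewrite !inE => /and4P[yX _ _ _].
    apply: contraNN (av y yX); rewrite !inE.
    by case/andP => /orP[/andP[_ ->]|->] /orP[/andP[_ ->]|->]; rewrite ?orbT.
  have cover A : A \in F -> exists2 B, B \in enum_fset Z & A \in [fset A in F | A `&` D == B].
    move=> AF; exists (A `&` D); last by move: AF; rewrite !inE => ->; rewrite eqxx.
    have := AF; rewrite !inE !fpowersetE => /andP[AU /avoidsP av].
    rewrite fsubsetIr andbT; apply: contraNneq (av x xX) => /fsetIidPr DA.
    have := XU x xX; rewrite !inE.
    have hA y : (y == x) || (y == phi x) -> (y \in U) || (y \in E) -> (y \in A) || (y \in E).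
      move=> yx /orP[yU|->]; last by rewrite orbT.
      by rewrite (fsubsetP DA) // !inE yU.
    by case/andP => /hA -> //; rewrite ?eqxx ?orbT // => /hA ->; rewrite ?eqxx ?orbT.
  apply: leq_trans (card_fset_union_bound cover) _.
  apply: leq_trans (_ : \sum_(B <- enum_fset Z) #|` F'| <= _)%N.
    by apply: leq_sum => B _; exact: slice.
  by rewrite big_const_seq count_predT iter_addn_0.
have := IH _ _ pX' X'U; rewrite -/F' => IH'.
have cU : #|` U| = (#|` D| + #|` U `\` D|)%N.
  by rewrite -(cardfsID D U) (fsetIidPr _) // fsubsetIl.
rewrite -/F cU expnD !expnS.
have d4 : ((2 ^ #|` D| - 1) * 4 <= 3 * 2 ^ #|` D|)%N.
  by case: #|` D| cD => [|[|[|]]].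
apply: leq_trans (leq_mul hF (leqnn _)) _.
have := leq_mul IH' d4; move: (2 ^ #|` D|)%N (2 ^ #|` U `\` D|)%N => a b.
by rewrite !mulnA; nia.
Qed.

End AvoidingPairs.

Lemma finite_uniform_bound (T : eqType) (s : seq T) (Q : T -> nat -> Prop) :
  (forall x n n', Q x n -> (n <= n')%N -> Q x n') ->
  (forall x, x \in s -> exists n, Q x n) ->
  exists N, forall x, x \in s -> Q x N.
Proof.
move=> mon; elim: s => [|y s IH] h; first by exists 0%N.
have [|N hN] := IH; first by move=> x xs; apply: h; rewrite inE xs orbT.
have [n hn] := h y (mem_head _ _); exists (maxn n N) => x.
rewrite inE => /predU1P[->|xs]; first by apply: mon hn _; exact: leq_maxl.
by apply: mon (hN x xs) _; exact: leq_maxr.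
Qed.

Lemma real_nat_bound (R : realType) (x : R) : exists n : nat, x <= n%:R.
Proof.
exists (Num.bound `|x|); apply: le_trans (ler_norm x) _.
by apply/ltW/archi_boundP.
Qed.

(** * Moving the two summands in opposite directions *)

Section Moves.
Variables (R : realType) (D m : nat).
Implicit Types v u : 'I_m -> 'rV[R]_D.

(** C bounds the weight that [v j] must give up when a point of the hull of v moves by
    [u i - u j]. *)
Definition cost_bound v u (C : nat) := forall i j, exists c : 'I_m -> R,
  [/\ forall l, 0 <= c l, \sum_l c l <= C%:R & u i - u j = \sum_l c l *: (v l - v j)].

Lemma exists_cost_bound v u : (forall i j, conic v j (u i - u j)) ->
  exists C, cost_bound v u C.
Proof.
move=> h.
have [||C hC] := @finite_uniform_bound _ (enum [set: 'I_m * 'I_m])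
  (fun ij (C : nat) => exists c : 'I_m -> R, [/\ forall l, 0 <= c l,
     \sum_l c l <= C%:R & u ij.1 - u ij.2 = \sum_l c l *: (v l - v ij.2)]).
- move=> [i j] n n' [c [c0 cn e]] nn'; exists c; split => //.
  by apply: le_trans cn _; rewrite ler_nat.
- move=> [i j] _; have [c [c0 e]] := h i j.
  by have [n hn] := real_nat_bound (\sum_l c l); exists n, c.
by exists C => i j; apply: (hC (i, j)); rewrite mem_enum inE.
Qed.

(** All weight except at most k per vertex sits at [v j], so x is within O(k) of t v_j. *)
Definition near v (t : R) j (k : R) x := exists w : 'I_m -> R,
  [/\ forall i, 0 <= w i, \sum_i w i = t, x = \sum_i w i *: v i &
      forall i, i != j -> w i <= k].

(** The first point pays at most tC at [v j] for the move; the second one transfers weight t from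
    [u i] to [u j]. *)
Lemma opposite_shift v u C (w w' : 'I_m -> R) (t : R) i j :
  cost_bound v u C -> (forall l, 0 <= w l) -> (forall l, 0 <= w' l) ->
  0 <= t -> t * C%:R <= w j -> t <= w' i ->
  hull v (\sum_l w l) (\sum_l w l *: v l + t *: (u i - u j)) /\
  hull u (\sum_l w' l) (\sum_l w' l *: u l - t *: (u i - u j)).
Proof.
move=> hC w0 w'0 t0 tw tw'; have [c [c0 cC e]] := hC i j; split.
  rewrite e scaler_sumr; under [X in _ + X]eq_bigr => l _ do rewrite scalerA.
  apply: hull_shift => // [l|]; first by rewrite mulr_ge0.
  by rewrite -mulr_sumr; apply: le_trans tw; rewrite ler_wpM2l.
have -> : - (t *: (u i - u j)) = \sum_l (t * (l == j)%:R) *: (u l - u i).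
  rewrite (bigD1 j) //= eqxx mulr1 big1 ?addr0.
    by rewrite -scalerN opprB.
  by move=> l /negPf ->; rewrite mulr0 scale0r.
apply: hull_shift => // [l|]; first by rewrite mulr_ge0.
rewrite (bigD1 j) //= eqxx mulr1 big1 ?addr0 //.
by move=> l /negPf ->; rewrite mulr0.
Qed.

(** By pigeonhole some w j is at least kC, so x can afford all moves t <= k at j. If w' i > k for
    some i != j, y can afford them too, contrary to the hypothesis; hence y is near [u j]. Then w' j
    is large, and exchanging the roles shows that x is near [v j]. *)
Lemma near_of_no_shift v u C (k n : nat) x y :
  (1 < m)%N -> cost_bound v u C -> cost_bound u v C ->
  (2 * m * C.+1 * k <= n)%N ->
  hull v n%:R x -> hull u n%:R y ->
  (forall i j, i != j -> exists2 t, (t <= k)%N &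
     ~ (hull v n%:R (x + t%:R *: (u i - u j)) /\ hull u n%:R (y - t%:R *: (u i - u j)))) ->
  (forall i j, i != j -> exists2 t, (t <= k)%N &
     ~ (hull u n%:R (y + t%:R *: (v i - v j)) /\ hull v n%:R (x - t%:R *: (v i - v j)))) ->
  exists j, near v n%:R j k%:R x /\ near u n%:R j k%:R y.
Proof.
move=> m1 hC hC' Ckn [w [w0 wn ->]] [w' [w'0 w'n ->]] no1 no2.
have kC : (k * C <= n %/ m)%N by rewrite leq_divRL; nia.
have [j wj] : exists j, (k * C)%:R <= w j.
  apply/existsP; apply: contraPT wn => /existsPn h; apply/eqP.
  rewrite lt_eqF //; have [j0 _] : exists j0 : 'I_m, true by exists (Ordinal (ltnW m1)).
  apply: lt_le_trans (_ : \sum_(i < m) (k * C)%:R <= _).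
    apply: ltr_sum; first by apply/hasP; exists j0; rewrite ?mem_index_enum.
    by move=> i _; rewrite ltNge h.
  by rewrite sumr_const card_ord -mulrnA ler_nat; have := leq_divM n m; nia.
have small (s : 'I_m -> R) : (forall i, 0 <= s i) -> \sum_i s i = n%:R ->
    (forall i, i != j -> s i <= k%:R) -> (k * C)%:R <= s j.
  move=> s0 sn sk; have : n%:R <= s j + \sum_(i < m) k%:R.
    rewrite -sn (bigD1 j) //= lerD2l; apply: le_trans (_ : \sum_(i | i != j) k%:R <= _).
      exact: ler_sum.
    by rewrite [leRHS](bigD1 j) //= lerDr.
  rewrite sumr_const card_ord -mulrnA => h.
  rewrite -(lerD2r (k * m)%:R); apply: le_trans h; rewrite -natrD ler_nat.
  nia.
have w'k i : i != j -> w' i <= k%:R.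
  move=> ij; rewrite leNgt; apply/negP => lt.
  have [t tk] := no1 i j ij; apply; rewrite -{1}wn -{1}w'n.
  apply: (opposite_shift hC) => //.
    by apply: le_trans wj; rewrite -natrM ler_nat leq_mul2r tk orbT.
  by apply: le_trans (ltW lt); rewrite ler_nat.
have w'j := small w' w'0 w'n w'k.
have wk i : i != j -> w i <= k%:R.
  move=> ij; rewrite leNgt; apply/negP => lt.
  have [t tk] := no2 i j ij; apply; rewrite -{1}w'n -{1}wn.
  apply: (opposite_shift hC') => //.
    by apply: le_trans w'j; rewrite -natrM ler_nat leq_mul2r tk orbT.
  by apply: le_trans (ltW lt); rewrite ler_nat.
by exists j; split; [exists w|exists w'].
Qed.

End Moves.

(** * Closeness to a vertex in terms of integer boxes *)

Section Boxes.
Variables (D : nat).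

Lemma box_leq b b' (x : 'rV[int]_D) : (b <= b')%N -> x \in box D b -> x \in box D b'.
Proof. by move=> bb /mem_box h; apply/mem_box => i; apply: leq_trans bb. Qed.

Lemma boxD b b' (x y : 'rV[int]_D) :
  x \in box D b -> y \in box D b' -> x + y \in box D (b + b').
Proof.
move=> /mem_box hx /mem_box hy; apply/mem_box => i; rewrite mxE.
by have := hx i; have := hy i; move: (x _ _) (y _ _) => a c; lia.
Qed.

Lemma boxN b (x : 'rV[int]_D) : x \in box D b -> - x \in box D b.
Proof. by move=> /mem_box h; apply/mem_box => i; rewrite mxE abszN. Qed.

Lemma exists_box (x : 'rV[int]_D) : exists b, x \in box D b.
Proof.
exists (\max_i `|x ord0 i|)%N; apply/mem_box => i; exact: (leq_bigmax i).
Qed.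

Lemma near_box (R : realType) m (v : 'I_m -> 'rV[int]_D) : exists B : nat,
  forall (n k : nat) j x, near (fun i => intv R (v i)) n%:R j k%:R (intv R x) ->
    x - v j *+ n \in box D (k * B).
Proof.
pose B := (\sum_i \sum_j \sum_(c < D) absz ((v i - v j)%R ord0 c))%N.
exists B => n k j x [w [w0 wn xE wk]]; apply/mem_box => c.
have := weights_sub (fun i => intv R (v i)) j wn.
rewrite -xE -intvMn -intvB => e.
have := congr1 (fun y : 'rV_D => `|y ord0 c|) e; rewrite mxE summxE => e'.
rewrite -(ler_nat R) natr_absz intr_norm e'.
apply: le_trans (ler_norm_sum _ _ _) _.
apply: le_trans (_ : \sum_i k%:R * (absz ((v i - v j)%R ord0 c))%:R <= _).
  apply: ler_sum => i _; rewrite -intvB !mxE normrM (ger0_norm (w0 i)).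
  rewrite natr_absz intr_norm.
  have [->|ij] := eqVneq i j; last by rewrite ler_wpM2r // wk.
  by rewrite subrr normr0 !mulr0.
rewrite -mulr_sumr natrM ler_wpM2l // -natr_sum ler_nat.
apply: leq_sum => i _; rewrite (bigD1 j) //=; apply: leq_trans (leq_addr _ _).
by rewrite [leqRHS](bigD1 c) //= leq_addr.
Qed.

End Boxes.

(** * Sums and differences with few representations *)

Section SignedSums.
Local Open Scope fset_scope.
Local Open Scope ring_scope.
Variables (R : realType) (D m : nat) (L : nat -> {fset 'rV[int]_D}) (cb : nat).
Variables (v : 'I_m -> 'rV[int]_D) (tau : 'I_m -> 'I_m) (e : int).
Local Notation iv := (@intv R D).
Local Notation rv := (fun i => iv (v i)).

(* e = 1 and tau = id for sums; e = -1 and tau the pairing of opposite vertices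
   for differences. *)
Definition svert i := e *: v (tau i).
Local Notation u := svert.
Local Notation ru := (fun i => iv (u i)).

Hypothesis hL : forall n z, (0 < n)%N -> (z \in L n) <-> hull rv n%:R (iv z).
Hypothesis hLbox : forall n z, z \in L n -> z \in box D (n * cb).
Hypothesis m1 : (1 < m)%N.
Hypothesis v_inj : injective v.
Hypothesis ee : e * e = 1.
Hypothesis tauK : involutive tau.
Hypothesis compat : forall j x, conic rv j x <-> conic ru j x.

Definition gsum (A : {fset 'rV[int]_D}) := [fset x + e *: y | x in A, y in A].
(** A representation z = x + e y is recorded by x; as e^2 = 1, the other summand is y = e (z -
    x). *)
Definition reps n z := [fset x in L n | e *: (z - x) \in L n].

Lemma sK (x : 'rV[int]_D) : e *: (e *: x) = x.
Proof. by rewrite scalerA ee scale1r. Qed.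

Lemma s_inj : injective (fun x : 'rV[int]_D => e *: x).
Proof. exact: can_inj sK. Qed.

Lemma gsumP A z :
  reflect (exists x y, [/\ x \in A, e *: y \in A & z = x + y]) (z \in gsum A).
Proof.
apply: (iffP idP) => [/imfset2P [x /= xA [y /= yB ->]]|[x [y [xA yB ->]]]].
  by exists x, (e *: y); rewrite sK.
by apply/imfset2P; exists x => //; exists (e *: y); rewrite ?sK.
Qed.

Lemma in_reps n z x : (x \in reps n z) = (x \in L n) && (e *: (z - x) \in L n).
Proof. by rewrite !inE. Qed.

(** Multiplication by e carries the vertices v to the points u, and the weights are relabelled by
    tau. *)
Lemma mem_L2 n y : (0 < n)%N -> (e *: y \in L n) <-> hull ru n%:R (iv y).
Proof.
move=> n0; rewrite hL //.
have er : e%:~R * e%:~R = 1 :> R by rewrite -intrM ee.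
rewrite intvZ; split=> -[w [w0 wn E]]; exists (w \o tau); split => //=.
- by rewrite -wn [RHS](reindex_inj (inv_inj tauK)).
- have -> : iv y = e%:~R *: (e%:~R *: iv y) by rewrite scalerA er scale1r.
  rewrite E scaler_sumr (reindex_inj (inv_inj tauK)) /=; apply: eq_bigr => i _.
  by rewrite /u intvZ !scalerA mulrC.
- by rewrite -wn [RHS](reindex_inj (inv_inj tauK)).
rewrite E scaler_sumr (reindex_inj (inv_inj tauK)) /=; apply: eq_bigr => i _.
by rewrite /u intvZ !scalerA tauK mulrAC er mul1r.
Qed.

Lemma u_inj : injective u.
Proof. by move=> i j /s_inj /v_inj /(inv_inj tauK). Qed.

(** Each integral move of the two summands yields another representation of x + y. If all moves t =
    0, ..., k along some direction were possible, there would be k + 1 of them. *)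
Lemma few_reps_near : exists C, forall n k x y, (0 < n)%N -> (C * k <= n)%N ->
  x \in L n -> e *: y \in L n -> (#|` reps n (x + y)| <= k)%N ->
  exists j, near rv n%:R j k%:R (iv x) /\ near ru n%:R j k%:R (iv y).
Proof.
have [C1 hC1] : exists C, cost_bound rv ru C.
  by apply: exists_cost_bound => i j; apply/compat; exact: conic_gen.
have [C2 hC2] : exists C, cost_bound ru rv C.
  by apply: exists_cost_bound => i j; apply/compat; exact: conic_gen.
pose C := maxn C1 C2.
have cost_le (p q : 'I_m -> 'rV[R]_D) C' :
    (C' <= C)%N -> cost_bound p q C' -> cost_bound p q C.
  move=> CC h i j; have [c [c0 cC E]] := h i j; exists c; split => //.
  by apply: le_trans cC _; rewrite ler_nat.
exists (2 * m * C.+1)%N => n k x y n0 Cn xL yL rk.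
have hx := (hL x n0).1 xL; have hy := (mem_L2 y n0).1 yL.
have many (d : 'rV[int]_D) : d != 0 -> ~ (forall t, (t <= k)%N ->
    x + d *+ t \in L n /\ e *: (y - d *+ t) \in L n).
  move=> d0 h; move: rk; apply/negP; rewrite -ltnNge.
  have inj : injective (fun t => x + d *+ t).
    by move=> t t' /addrI; apply: mulrn_vec_inj.
  have [K kK] : exists K, K = k.+1 by exists k.+1.
  have <- : #|` [fset x + d *+ t | t in iota 0 K]| = k.+1.
    by rewrite card_imfset //= undup_id ?iota_uniq // size_iota.
  apply/fsubset_leq_card/fsubsetP => _ /imfsetP [t /= + ->].
  rewrite mem_iota kK => tk; have [h1 h2] := h t tk.
  by rewrite !inE h1 /= opprD addrACA subrr add0r.
have k1 := cost_le _ _ _ (leq_maxl _ _) hC1.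
have k2 := cost_le _ _ _ (leq_maxr _ _) hC2.
apply: (near_of_no_shift m1 k1 k2 Cn hx hy) => i j ij.
  apply: contrapT => no; apply: (many (u i - u j)).
    by rewrite subr_eq0 (inj_eq u_inj).
  move=> t tk; apply: contrapT => no'; apply: no; exists t => // -[h1 h2].
  apply: no'; split; first by apply/hL; rewrite // intvD intvMn intvB.
  by apply/mem_L2; rewrite // intvB intvMn intvB.
apply: contrapT => no; apply: (many (- (v i - v j))).
  by rewrite oppr_eq0 subr_eq0 (inj_eq v_inj).
move=> t tk; apply: contrapT => no'; apply: no; exists t => // -[h1 h2].
apply: no'; split; rewrite mulNrn.
  by apply/hL; rewrite // intvB intvMn intvB.
by rewrite opprK; apply/mem_L2; rewrite // intvD intvMn intvB.
Qed.

Lemma few_reps_box : exists C B : nat, forall n k x y, (0 < n)%N -> (C * k <= n)%N ->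
  x \in L n -> e *: y \in L n -> (#|` reps n (x + y)| <= k)%N ->
  exists j, x - v j *+ n \in box D (k * B) /\ y - u j *+ n \in box D (k * B).
Proof.
have [C hC] := few_reps_near; have [B1 hB1] := near_box R v.
have [B2 hB2] := near_box R u.
exists C, (B1 + B2)%N => n k x y n0 Cn xL yL rk.
have [j [nx ny]] := hC n k x y n0 Cn xL yL rk; exists j; split.
  by apply: box_leq (hB1 _ _ _ _ nx); nia.
by apply: box_leq (hB2 _ _ _ _ ny); nia.
Qed.

(** If Ck <= n, then z lies in a box of radius O(k) about some n(v_j + u_j). If n < Ck, all of nP +
    e nP lies in such a box about 0. *)
Lemma card_few_reps : exists C, forall n k, (0 < n)%N ->
  (#|` [fset z in gsum (L n) | (#|` reps n z| <= k)%N]| <= C * k.+1 ^ D)%N.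
Proof.
have [C [B hCB]] := few_reps_box.
pose b0 := (2 * B + 2 * C * cb)%N.
exists (m.+1 * (2 * b0).+1 ^ D)%N => n k n0.
pose cs := 0 :: [seq (v j + u j) *+ n | j <- enum 'I_m].
pose F c := [fset c + w | w in box D (k * b0)].
apply: leq_trans (_ : \sum_(c <- cs) #|` F c| <= _)%N.
  apply: card_fset_union_bound => z; rewrite !inE => /andP[/gsumP [x [y [xL yL ->]]] zk].
  have [Cn|nC] := leqP (C * k) n.
    have [j [hx hy]] := hCB n k x y n0 Cn xL yL zk.
    exists ((v j + u j) *+ n).
      by rewrite inE; apply/orP; right; apply/map_f; rewrite mem_enum.
    apply/imfsetP; exists ((x - v j *+ n) + (y - u j *+ n)).
      by apply: box_leq (boxD hx hy); rewrite /b0; nia.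
    by rewrite addrACA -opprD -mulrnDl [RHS]addrC subrK.
  exists 0; first exact: mem_head.
  apply/imfsetP; exists (x + y); last by rewrite add0r.
  have yb : y \in box D (n * cb).
    apply/mem_box => i; have /hLbox/mem_box := yL => /(_ i).
    rewrite mxE abszM; have : (absz e * absz e = 1)%N by rewrite -abszM ee.
    by move/eqP; rewrite muln_eq1 => /andP[/eqP -> _]; rewrite mul1n.
  by apply: box_leq (boxD (hLbox xL) yb); rewrite /b0; nia.
have cF c : (#|` F c| <= (2 * b0).+1 ^ D * k.+1 ^ D)%N.
  apply: leq_trans (leq_imfset_card _ _ _) _ => /=.
  apply: leq_trans (size_undup _) _.
  by rewrite size_box -expnMn; case: (D) => // D'; rewrite leq_exp2r //; nia.
apply: leq_trans (_ : \sum_(c <- cs) ((2 * b0).+1 ^ D * k.+1 ^ D) <= _)%N.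
  by apply: leq_sum => c _; exact: cF.
rewrite big_const_seq count_predT iter_addn_0 /= size_map size_enum_ord.
by rewrite mulnC mulnA.
Qed.

(** Discarding the representations that meet M leaves at least r(z) - 2 c0 of them, so a random A
    misses z with probability at most (3/4)^((r(z) - 2 c0) / 3). The union bound is grouped by the
    value k of r(z), with at most C(k+1)^D points for each k, and [geometric_tail] bounds the sum by
    1/4. *)
Lemma few_bad_sets c0 : exists k0 : nat, forall n (M U E : {fset 'rV[int]_D}),
  (0 < n)%N -> (#|` M| <= c0)%N ->
  (forall x, x \in L n -> x \notin M -> x \in U `|` E) ->
  (#|` [fset A in fpowerset U | `[< exists z, [/\ z \in gsum (L n),
       (k0 < #|` reps n z|)%N & z \notin gsum (A `|` E)] >]]|)%:R
    <= 4^-1 * 2 ^+ #|` U| :> R.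
Proof.
have [C hC] := card_few_reps.
have [k0 hk0] := geometric_tail R C D (2 * c0).
exists k0 => n M U E n0 Mc hU.
set G := [fset A in _ | _].
pose r z := #|` reps n z|.
pose Z := [fset z in gsum (L n) | (k0 < r z)%N].
pose phi (z x : 'rV[int]_D) := e *: (z - x).
pose X z := [fset x in reps n z | (x \notin M) && (phi z x \notin M)].
pose F z := [fset A in fpowerset U | avoids (phi z) E (X z) A].
pose p z := ((r z - 2 * c0) %/ 3)%N.
have memX z x : (x \in X z) = [&& x \in reps n z, x \notin M & phi z x \notin M].
  by rewrite !inE.
have phi_inj z : injective (phi z) by move=> x y /s_inj /addrI /oppr_inj.
have cover A : A \in G -> exists2 z, z \in enum_fset Z & A \in F z.
  rewrite !inE => /andP[AU /asboolP [z [zL zk zA]]]; exists z.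
    by rewrite !inE zL.
  rewrite !inE AU; apply/avoidsP => x _.
  apply: contra zA => /andP[xA yA]; apply/gsumP; exists x, (z - x); split => //.
  by rewrite addrC subrK.
have cF z : (#|` F z|)%:R <= (3 / 4) ^+ p z * 2 ^+ #|` U| :> R.
  have h : (#|` F z| * 4 ^ p z <= 3 ^ p z * 2 ^ #|` U|)%N.
    apply: (card_avoids (@phi_inj z)).
      pose M' := [fset z - e *: y | y in M].
      have sub : reps n z `<=` X z `|` (M `|` M').
        apply/fsubsetP => x xr; rewrite !in_fsetU memX xr /=.
        have [xM|xM] := boolP (x \in M); first by [].
        have [yM|yM] := boolP (phi z x \in M); last by [].
        apply/orP; right; apply/imfsetP; exists (phi z x) => //.
        by rewrite sK subKr.
      have rX : (r z <= #|` X z| + (c0 + c0))%N.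
        apply: leq_trans (fsubset_leq_card sub) _.
        apply: leq_trans (card_fsetU_le _ _) _; rewrite leq_add2l.
        apply: leq_trans (card_fsetU_le _ _) _; apply: leq_add => //.
        by apply: leq_trans (leq_imfset_card _ _ _) _.
      rewrite mulnC; apply: leq_trans (leq_divM _ 3) _; rewrite leq_subLR.
      by apply: leq_trans rX _; rewrite mul2n -addnn addnC.
    move=> x; rewrite memX in_reps => /andP[/andP[xL yL] /andP[xM yM]].
    have := hU _ xL xM; have := hU _ yL yM; rewrite !inE => -> ->.
    by [].
  rewrite expr_div_n mulrAC ler_pdivlMr ?exprn_gt0 //.
  by rewrite -!natrX -!natrM ler_nat.
have cG : (#|` G|)%:R <= \sum_(z <- enum_fset Z) (#|` F z|)%:R :> R.
  by rewrite -natr_sum ler_nat; apply: card_fset_union_bound.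
apply: le_trans cG _.
apply: le_trans (_ : \sum_(z <- enum_fset Z) (3 / 4) ^+ p z * 2 ^+ #|` U| <= _).
  by apply: ler_sum => z _.
rewrite -mulr_suml ler_wpM2r ?exprn_ge0 //.
pose K := (#|` L n|).+1; apply: le_trans (hk0 K).
pose f k := (3 / 4) ^+ ((k - 2 * c0) %/ 3) : R.
have f0 k : 0 <= f k by rewrite exprn_ge0 // divr_ge0.
(* The points z are sorted by their number of representations. *)
have -> : \sum_(z <- enum_fset Z) (3 / 4) ^+ p z =
  \sum_(z <- enum_fset Z) \sum_(k0 <= k < K | k == r z) f k.
  rewrite big_seq [RHS]big_seq; apply: eq_bigr => z; rewrite !inE => /andP[_ zk].
  rewrite big_nat1_eq (ltnW zk) /K ltnS fsubset_leq_card //.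
  by apply/fsubsetP => x; rewrite !inE => /andP[].
rewrite (exchange_big_dep predT) //=; apply: ler_sum => k _.
rewrite big_const_seq iter_addr_0 -[X in X <= _]mulr_natl ler_wpM2r ?f0 // ler_nat.
rewrite -size_filter; apply: leq_trans (hC n k n0).
apply: uniq_leq_size; first by rewrite filter_uniq ?fset_uniq.
move=> z; rewrite mem_filter => /andP[/eqP ->]; rewrite !inE => /andP[zL _].
by rewrite zL /r leqnn.
Qed.

End SignedSums.

(** * Lattice points on an extreme ray *)

Section ExtremeRay.
Variables (R : realType) (D m : nat).

(** The box contains finitely many w. A cone point with coefficients c fits into nP at [v j] as soon
    as n is at least the sum of c. *)
Lemma conic_box_hull (v : 'I_m -> 'rV[int]_D) b : exists N : nat,
  forall n j (w : 'rV[int]_D), (N <= n)%N -> w \in box D b ->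
    conic (fun i => intv R (v i)) j (intv R w) ->
    hull (fun i => intv R (v i)) n%:R (intv R (v j *+ n + w)).
Proof.
pose Q (j : 'I_m) (w : 'rV[int]_D) (N : nat) := forall n, (N <= n)%N ->
  conic (fun i => intv R (v i)) j (intv R w) ->
  hull (fun i => intv R (v i)) n%:R (intv R (v j *+ n + w)).
have [||N hN] := @finite_uniform_bound _ (allpairs pair (enum 'I_m) (box D b))
    (fun jw => Q jw.1 jw.2).
- by move=> [j w] N N' h NN n Nn; apply: h; apply: leq_trans Nn.
- move=> [j w] _ /=.
  have [[c [c0 E]]|no] := pselect (conic (fun i => intv R (v i)) j (intv R w)).
    have [N hN] := real_nat_bound (\sum_i c i); exists N => n Nn _.
    rewrite intvD intvMn E; apply: hull_add_conic => //.
    by apply: le_trans hN _; rewrite ler_nat.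
  by exists 0%N => n _ /no.
exists N => n j w Nn wb; apply: (hN (j, w)) => //.
by apply/allpairsP; exists (j, w); rewrite mem_enum.
Qed.

(* A generator g maximizing |g| / h g, with h > 0 on the cone, spans an extreme
   ray: |x| <= M h x on the whole cone, and equality at x + y = lam g forces
   equality in the triangle inequality, so x and y are parallel. *)
Lemma extreme_generator (v : 'I_m -> 'rV[R]_D) a p : (1 < m)%N -> exposes v a p ->
  exists2 i, i != p & forall x y lam, conic v p x -> conic v p y ->
    x + y = lam *: (v i - v p) -> exists2 mu, 0 <= mu & x = mu *: (v i - v p).
Proof.
move=> m1 ap; have [i0 i0p] := exists_other m1 p.
pose g i := v i - v p; pose h := dotp (- a).
have hg i : i != p -> 0 < h (g i).
  by move=> /ap; rewrite /h dotpNl dotpBr opprB subr_gt0.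
have hg0 i : 0 <= h (g i).
  by have [->|/hg/ltW//] := eqVneq i p; rewrite /g subrr /h dotp0r.
pose rho i := dotp (g i) (g i) / h (g i) ^+ 2.
pose l := [arg max_(i > i0 | i != p) rho i]%O.
have [lp lmax] : l != p /\ forall i, i != p -> rho i <= rho l.
  by rewrite /l; case: arg_maxP.
exists l => // x y lam px py xy; rewrite -/(g l) in xy *.
pose r := rho l; have r0 : 0 <= r by rewrite divr_ge0 ?dotpp_ge0 ?sqr_ge0.
have norm1 i : dotp (g i) (g i) <= r * h (g i) ^+ 2.
  have [->|ip] := eqVneq i p; first by rewrite /g subrr /h !dotp0r expr0n mulr0.
  by rewrite -ler_pdivrMr ?exprn_gt0 ?hg //; exact: lmax.
have dot1 i k : dotp (g i) (g k) <= r * (h (g i) * h (g k)).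
  rewrite leNgt; apply/negP => lt.
  have B0 : 0 <= r * (h (g i) * h (g k)) by apply: mulr_ge0 => //; apply: mulr_ge0; exact: hg0.
  have := ltr_pM B0 B0 lt lt; rewrite -!expr2 ltNge => /negP; apply.
  apply: le_trans (dotp_cauchy_schwarz _ _) _.
  apply: le_trans (ler_pM (dotpp_ge0 _) (dotpp_ge0 _) (norm1 i) (norm1 k)) _.
  by rewrite le_eqVlt; apply/orP; left; apply/eqP; ring.
have dot2 i z : conic v p z -> dotp (g i) z <= r * (h (g i) * h z).
  move=> [c [c0 ->]]; rewrite /h !dotp_sumr !mulr_sumr; apply: ler_sum => k _.
  rewrite !dotpZr -/(g k) -/(h (g k)).
  have := ler_wpM2l (c0 k) (dot1 i k); rewrite /h => E; apply: le_trans E _.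
  by rewrite le_eqVlt; apply/orP; left; apply/eqP; ring.
have dot3 z z' : conic v p z -> conic v p z' -> dotp z z' <= r * (h z * h z').
  move=> [c [c0 ->]] pz'; rewrite dotpC /h !dotp_sumr mulr_suml mulr_sumr.
  apply: ler_sum => k _; rewrite !dotpZr -/(g k) dotpC.
  have := ler_wpM2l (c0 k) (dot2 k z' pz'); rewrite /h => E; apply: le_trans E _.
  by rewrite le_eqVlt; apply/orP; left; apply/eqP; ring.
have hc z : conic v p z -> 0 <= h z.
  move=> [c [c0 ->]]; rewrite /h dotp_sumr; apply: sumr_ge0 => k _.
  by rewrite dotpZr; apply: mulr_ge0 => //; exact: hg0.
have hxy : h x + h y = lam * h (g l) by rewrite /h -dotpDr xy dotpZr.
have gl : dotp (g l) (g l) = r * h (g l) ^+ 2.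
  by rewrite /r /rho divfK // gt_eqF // exprn_gt0 // hg.
have Nxy : dotp x x + 2 * dotp x y + dotp y y = r * (h x + h y) ^+ 2.
  have : dotp (x + y) (x + y) = r * (h x + h y) ^+ 2.
    rewrite hxy exprMn mulrCA -gl xy dotpZl dotpZr; ring.
  by move=> <-; rewrite dotpDr !dotpDl (dotpC y x); ring.
have := dot3 x x px px; have := dot3 x y px py; have := dot3 y y py py.
move: Nxy (hc x px) (hc y py) hxy.
set X := dotp x x; set Y := dotp y y; set Z := dotp x y.
move: (h x) (h y) (hg l lp) => hx hy hl Nxy hx0 hy0 hxy eY eZ eX.
(* The three upper bounds add up to the equality [Nxy], so each of them is sharp. *)
have EX : X = r * (hx * hx) by move: Nxy; rewrite expr2; lra.
have EY : Y = r * (hy * hy) by move: Nxy; rewrite expr2; lra.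
have EZ : Z = r * (hx * hy) by move: Nxy; rewrite expr2; lra.
have par : hy *: x = hx *: y.
  apply/eqP; rewrite -subr_eq0; apply/eqP/dotpp_eq0.
  rewrite !(dotpBl, dotpBr, dotpZl, dotpZr) (dotpC y x) -/X -/Y -/Z EX EY EZ; ring.
have [s0|s0] := eqVneq (hx + hy) 0.
  exists 0 => //; rewrite scale0r; apply: dotpp_eq0; rewrite -/X EX.
  have -> : hx = 0 by lra.
  by rewrite mul0r mulr0.
have lam0 : 0 <= lam by rewrite -(pmulr_lge0 _ hl) -hxy addr_ge0.
have sp : 0 < hx + hy by rewrite lt_def s0 addr_ge0.
exists (hx * lam / (hx + hy)); first by rewrite !mulr_ge0 // invr_ge0 ltW.
have -> : x = (hx + hy)^-1 *: ((hx + hy) *: x).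
  by rewrite scalerA mulVf // scale1r.
by rewrite scalerDl par -scalerDr xy !scalerA mulrC.
Qed.

(** f is a shortest lattice vector on an extreme ray, measured by a coordinate in which the ray does
    not vanish. Division with remainder makes every lattice point of the ray a multiple of f. *)
Lemma exists_lattice_ray (v : 'I_m -> 'rV[int]_D) p : (1 < m)%N -> injective v ->
  (exists a, exposes (fun i => intv R (v i)) a p) ->
  exists f : 'rV[int]_D, [/\ f != 0, conic (fun i => intv R (v i)) p (intv R f) &
    forall (x y : 'rV[int]_D) t, conic (fun i => intv R (v i)) p (intv R x) ->
      conic (fun i => intv R (v i)) p (intv R y) ->
      x + y = f *+ t -> exists k, x = f *+ k].
Proof.
move=> m1 vi [a ap].
have [i ip hi] := extreme_generator m1 ap.
pose g := v i - v p.
have g0 : g != 0 by rewrite subr_eq0 (inj_eq vi).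
have gE : intv R (v i) - intv R (v p) = intv R g by rewrite intvB.
rewrite gE in hi.
have [c gc] : exists c, g ord0 c != 0.
  apply/existsP; apply: contraNT g0 => /existsPn h; apply/eqP/rowP => c.
  by have := h c; rewrite negbK => /eqP e; rewrite [RHS]mxE; exact: e.
pose S n := `[< exists f : 'rV[int]_D, exists mu : R,
  [/\ 0 < mu, intv R f = mu *: intv R g & absz (f ord0 c) = n] >].
have exS : exists n, S n.
  by exists (absz (g ord0 c)); apply/asboolP; exists g, 1; split; rewrite ?scale1r ?ltr01.
case: (ex_minnP exS) => n0 /asboolP [f [mu [mu0 fE fn]]] nmin.
have coordE (x : 'rV[int]_D) nu : intv R x = nu *: intv R g ->
    (absz (x ord0 c))%:R = `|nu| * (absz (g ord0 c))%:R :> R.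
  move=> E; have := congr1 (fun y : 'rV_D => `|y ord0 c|) E.
  by rewrite !mxE normrM !natr_absz !intr_norm.
have gc0 : 0 < (absz (g ord0 c))%:R :> R by rewrite ltr0n absz_gt0.
exists f; split.
- apply/eqP => f0; move: (coordE f mu fE); rewrite f0 mxE absz0 => /esym/eqP.
  by rewrite mulf_eq0 normr_eq0 !gt_eqF.
- by rewrite fE; apply: conicZ; [exact: ltW|rewrite -gE; exact: conic_gen].
move=> x y t px py xy.
have [nu nu0 xE] : exists2 nu, 0 <= nu & intv R x = nu *: intv R g.
  apply: (hi _ (intv R y) (t%:R * mu)) => //.
  by rewrite -intvD xy intvMn fE scalerA.
have lam0 : 0 <= nu / mu by rewrite divr_ge0 // ltW.
(* The remainder [x - f *+ k] is on the ray and shorter than f, hence zero. *)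
pose k := Num.truncn (nu / mu).
have /andP[kl lk] : k%:R <= nu / mu < k.+1%:R by exact: truncn_itv.
exists k; apply: (@intv_inj R).
have xk : intv R (x - f *+ k) = (nu - k%:R * mu) *: intv R g.
  by rewrite intvB intvMn xE fE scalerA -scalerBl.
have nk0 : 0 <= nu - k%:R * mu by rewrite subr_ge0 -ler_pdivlMr.
have [nk|nk] := eqVneq (nu - k%:R * mu) 0.
  apply/eqP; rewrite -subr_eq0 -intvB xk nk scale0r //.
have : (n0 <= absz ((x - f *+ k)%R ord0 c))%N.
  by apply: nmin; apply/asboolP; exists (x - f *+ k), (nu - k%:R * mu); split; rewrite // lt_def nk.
rewrite -fn -(ler_nat R) (coordE _ _ fE) (coordE _ _ xk) ler_pM2r //.
rewrite !ger0_norm ?(ltW mu0) // leNgt => /negP; case.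
rewrite ltrBlDr; move: lk; rewrite ltr_pdivrMr // -addn1 natrD; lra.
Qed.

End ExtremeRay.

(** * Exactly which sums are missed for a prescribed fringe *)

Section Fringe.
Local Open Scope fset_scope.
Local Open Scope ring_scope.
Variables (R : realType) (D m : nat) (L M : nat -> {fset 'rV[int]_D}) (cb : nat).
Variables (v : 'I_m -> 'rV[int]_D) (tau : 'I_m -> 'I_m) (e : int).
Local Notation iv := (@intv R D).
Local Notation rv := (fun i => iv (v i)).
Local Notation u := (svert v tau e).
Local Notation ru := (fun i => iv (u i)).

Hypothesis hL : forall n z, (0 < n)%N -> (z \in L n) <-> hull rv n%:R (iv z).
Hypothesis hLbox : forall n z, z \in L n -> z \in box D (n * cb).
Hypothesis m1 : (1 < m)%N.
Hypothesis v_inj : injective v.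
Hypothesis ee : e * e = 1.
Hypothesis tauK : involutive tau.
Hypothesis compat : forall j x, conic rv j x <-> conic ru j x.

(* At the vertex n v_j of nP the fringe keeps every lattice point except those
   n v_j + t ray_j with t not in keep j. *)
Variables (ray : 'I_m -> 'rV[int]_D) (keep : 'I_m -> pred nat) (T : nat).
Local Notation keep2 j := (keep (tau j)).
Hypothesis ray_tau : forall j, e *: ray j = ray (tau j).
Hypothesis keep0 : forall j, keep j 0%N.
Hypothesis keep_large : forall j t, (T <= t)%N -> keep j t.
Hypothesis ray_extreme : forall j, ((forall t, keep j t) /\ (forall t, keep2 j t)) \/
  [/\ ray j != 0, conic rv j (iv (ray j)) &
      forall (x y : 'rV[int]_D) t, conic rv j (iv x) -> conic rv j (iv y) ->
        x + y = ray j *+ t -> exists k, x = ray j *+ k].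
Hypothesis mem_M : forall n x,
  (x \in M n) <-> exists j t, ~~ keep j t /\ x = v j *+ n + ray j *+ t.

Lemma mem_M2 n y :
  (e *: y \in M n) <-> exists j t, ~~ keep2 j t /\ y = u j *+ n + ray j *+ t.
Proof.
rewrite mem_M; split=> -[j [t [jt E]]]; exists (tau j), t; rewrite ?tauK; split => //.
  by rewrite -[y](sK ee) E scalerDr /svert tauK -ray_tau !scalerMnr.
by rewrite E scalerDr /svert !scalerMnr !scalerA ee scale1r -scalerMnr ray_tau.
Qed.

Lemma box_sign b (x : 'rV[int]_D) : x \in box D b -> e *: x \in box D b.
Proof.
move=> /mem_box h; apply/mem_box => i; rewrite mxE abszM.
have : (absz e * absz e = 1)%N by rewrite -abszM ee.
by move/eqP; rewrite muln_eq1 => /andP[/eqP -> _]; rewrite mul1n.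
Qed.

Lemma box_mulrn b (x : 'rV[int]_D) s t : (s <= t)%N ->
  x *+ t \in box D b -> x *+ s \in box D b.
Proof.
move=> st /mem_box h; apply/mem_box => i; have := h i; rewrite !mulmxnE.
rewrite -(mulr_natr _ t) -(mulr_natr _ s) !abszM !natz !absz_nat; apply: leq_trans.
by rewrite leq_mul2l st orbT.
Qed.

Lemma mulrn_not_box b n (x : 'rV[int]_D) : x != 0 -> (b < n)%N -> x *+ n \notin box D b.
Proof.
move=> x0 bn; apply: contraNN x0 => /mem_box h; apply/eqP/rowP => i.
rewrite [RHS]mxE; have := h i; rewrite mulmxnE -mulr_natr abszM natz absz_nat.
rewrite !ord1 => hn; apply/eqP; rewrite -absz_eq0.
by move: hn; case: (absz _) => // k hn; exfalso; move: hn; rewrite mulSn; lia.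
Qed.

Lemma ray_box : exists b, forall j t, (t < T)%N -> ray j *+ t \in box D b.
Proof.
have [||b hb] := @finite_uniform_bound _ (allpairs pair (enum 'I_m) (iota 0 T))
    (fun jt b => ray jt.1 *+ jt.2 \in box D b).
- by move=> jt b b' h bb; apply: box_leq h.
- by move=> jt _; exact: exists_box.
exists b => j t tT; apply: (hb (j, t)); apply/allpairsP; exists (j, t).
by rewrite mem_enum mem_iota.
Qed.

(** The fringes at distinct vertices drift apart as n grows, so a point close to vertex j can only
    be omitted by the fringe at j. The family c is kept general to serve both v and u. *)
Lemma not_in_M (c : 'I_m -> 'rV[int]_D) (kp : 'I_m -> pred nat) b n b1 j (d : 'rV[int]_D) :
  injective c -> (forall i t, (t < T)%N -> ray i *+ t \in box D b) ->
  (forall i t, (T <= t)%N -> kp i t) ->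
  (b1 + b < n)%N -> d \in box D b1 ->
  (forall s, ~~ kp j s -> d <> ray j *+ s) ->
  ~ exists i t, ~~ kp i t /\ c j *+ n + d = c i *+ n + ray i *+ t.
Proof.
move=> c_inj hb kpT bn db hd [i [t [it E]]].
have tT : (t < T)%N by rewrite ltnNge; apply: contra it => /kpT ->.
have [ij|ij] := eqVneq i j; first by rewrite ij in E it; move/addrI: E; exact: hd.
have /negP : (c i - c j) *+ n \notin box D (b1 + b).
  by apply: mulrn_not_box => //; rewrite subr_eq0 (inj_eq c_inj).
apply; suff -> : (c i - c j) *+ n = d - ray i *+ t by apply: boxD => //; exact/boxN/hb.
by apply/eqP; rewrite mulrnBl subr_eq addrAC eq_sym subr_eq addrC E.
Qed.

(** A missed z has few representations, so the summands of each are near paired vertices. Its offset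
    w from n(v_j + u_j) must lie on the ray, with position t outside keep j + keep2 j; otherwise two
    kept summands represent z. Conversely, both summands of a point on an extreme ray lie on that
    ray, so such a t is never reached. *)
Lemma missing_points k0 : exists N b0 : nat, forall n (A : {fset 'rV[int]_D}),
  (N <= n)%N -> A `<=` L n ->
  (forall x, x \in A -> x \notin M n) ->
  (forall x, x \in L n -> x \notin M n ->
     (exists j, x - v j *+ n \in box D b0) -> x \in A) ->
  (forall z, z \in gsum e (L n) -> (k0 < #|` reps L e n z|)%N -> z \in gsum e A) ->
  forall z, z \in gsum e (L n) `\` gsum e A <->
    exists j t, ~~ nsum (keep j) (keep2 j) t /\ z = (v j + u j) *+ n + ray j *+ t.
Proof.
have u_inj' := u_inj v_inj ee tauK.
have [C [B hCB]] := few_reps_box hL m1 v_inj ee tauK compat.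
have [bT hbT] := ray_box.
pose b1 := (k0 * B + k0 * B + bT)%N.
have [N1 hN1] := conic_box_hull R v b1.
have [N2 hN2] := conic_box_hull R u b1.
exists (maxn (C * k0) (maxn N1 (maxn N2 (b1 + bT).+1))), (k0 * B)%N.
move=> n A; rewrite !geq_max => /andP[Cn /andP[nN1 /andP[nN2 nb]]].
have n0 : (0 < n)%N by apply: leq_trans nb.
move=> AL AM AE few z.
have inL1 j w : w \in box D b1 -> conic rv j (iv w) -> v j *+ n + w \in L n.
  by move=> wb jw; apply/hL => //; exact: hN1.
have inL2 j w : w \in box D b1 -> conic rv j (iv w) -> e *: (u j *+ n + w) \in L n.
  move=> wb jw; apply/(mem_L2 hL ee tauK) => //; apply: hN2 => //.
  exact/compat.
have cL1 j x : x \in L n -> conic rv j (iv (x - v j *+ n)).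
  by move=> /(hL _ n0) /(hull_conic j); rewrite intvB intvMn.
have cL2 j y : e *: y \in L n -> conic rv j (iv (y - u j *+ n)).
  by move=> /(mem_L2 hL ee tauK _ n0) /(hull_conic j) h; apply/compat; rewrite intvB intvMn.
have lt_T j t : ~~ nsum (keep j) (keep2 j) t -> (t < T)%N.
  move=> h; rewrite ltnNge; apply: contra h => Tt; apply/nsumP.
  by exists 0%N, t; rewrite keep0 keep_large.
split; last first.
  move=> [j [t [jt ->]]]; have tT := lt_T _ _ jt.
  have [[k1 k2]|[f0 fc face]] := ray_extreme j.
    by case/negP: jt; apply/nsumP; exists 0%N, t.
  rewrite inE; apply/andP; split; last first.
    apply/gsumP => //; exists (v j *+ n), (u j *+ n + ray j *+ t); split.
    - rewrite -[v j *+ n]addr0; apply: inL1.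
        by apply/mem_box => i; rewrite mxE.
      by rewrite intv0; exact: conic0.
    - apply: inL2; first by apply: box_leq (hbT j t tT); rewrite /b1 leq_addl.
      by rewrite intvMn; apply: conicZ.
    - by rewrite addrA mulrnDl.
  apply/negP => /(gsumP ee) [x [y [xA yA E]]].
  have xc := cL1 j x (fsubsetP AL _ xA); have yc := cL2 j y (fsubsetP AL _ yA).
  have xyt : (x - v j *+ n) + (y - u j *+ n) = ray j *+ t.
    by rewrite addrACA -opprD -mulrnDl -E [_ + ray j *+ t]addrC addrK.
  have [a xa] := face _ _ _ xc yc xyt.
  have [b yb] : exists b, y - u j *+ n = ray j *+ b.
    by apply: (face _ _ t yc xc); rewrite addrC.
  move: xyt; rewrite xa yb -mulrnDr => /(mulrn_vec_inj f0) abt.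
  move: jt => /nsumP; apply; exists a, b; split => //.
    apply: contraPT (xA) => ka; apply/negP; apply: contraTN (ka) => /AM xM.
    by case/negP: xM; apply/mem_M; exists j, a; rewrite -xa addrC subrK.
  apply: contraPT (yA) => ka; apply/negP; apply: contraTN (ka) => /AM xM.
  by case/negP: xM; apply/mem_M2; exists j, b; rewrite -yb addrC subrK.
rewrite inE => /andP[zA zL].
have rk : (#|` reps L e n z| <= k0)%N.
  by rewrite leqNgt; apply: contra zA; exact: few.
(* Near the vertices only points of M are absent from A, so every representation of a missed z uses
   one. *)
have key x y : x \in L n -> e *: y \in L n -> z = x + y ->
    x \in M n \/ e *: y \in M n.
  move=> xL yL E; apply: contrapT => /not_orP [/negP xM /negP yM].
  have [j [xj yj]] := hCB n k0 x y n0 Cn xL yL (eq_ind z (fun z => #|` reps L e n z| <= k0)%N rk _ E).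
  case/negP: zA; apply/(gsumP ee); exists x, y; split => //.
    by apply: AE => //; exists j.
  apply: AE => //; exists (tau j).
  have -> : e *: y - v (tau j) *+ n = e *: (y - u j *+ n).
    by rewrite scalerBr /svert scalerMnr scalerA ee scale1r.
  exact: box_sign.
have keepT j t : (T <= t)%N -> keep2 j t by exact: keep_large.
have nM1 j w : w \in box D b1 -> (forall s, ~~ keep j s -> w <> ray j *+ s) ->
    ~ (v j *+ n + w \in M n).
  by move=> wb hw /mem_M; apply: (not_in_M v_inj hbT keep_large nb wb hw).
have nM2 j w : w \in box D b1 -> (forall s, ~~ keep2 j s -> w <> ray j *+ s) ->
    ~ (e *: (u j *+ n + w) \in M n).
  by move=> wb hw /mem_M2; apply: (@not_in_M u (fun j => keep2 j) _ _ _ _ _ u_inj' hbT keepT nb wb hw).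
have /(gsumP ee) [x [y [xL yL zE]]] := zL.
have [j [xj yj]] := hCB n k0 x y n0 Cn xL yL (eq_ind z (fun z => #|` reps L e n z| <= k0)%N rk _ zE).
exists j.
have xj1 : x - v j *+ n \in box D b1 by apply: box_leq xj; rewrite /b1; lia.
have yj1 : y - u j *+ n \in box D b1 by apply: box_leq yj; rewrite /b1; lia.
have [[k1 k2]|[f0 fc face]] := ray_extreme j.
  case: (key x y xL yL zE).
    rewrite -[x](subrK (v j *+ n)) addrC => /nM1 []// s.
    by rewrite k1.
  rewrite -[y](subrK (u j *+ n)) [_ - _ + _]addrC => /nM2 []// s.
  by rewrite k2.
pose w := (x - v j *+ n) + (y - u j *+ n).
have wb : w \in box D b1 by apply: box_leq (boxD xj yj); rewrite /b1; lia.
have wc : conic rv j (iv w) by rewrite intvD; apply: conicD; [exact: cL1|exact: cL2].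
have zw : z = (v j + u j) *+ n + w.
  by rewrite zE /w addrACA -opprD -mulrnDl [RHS]addrC subrK.
have box0 : 0 \in box D b1 by apply/mem_box => i; rewrite mxE.
have [[t wt]|now] := pselect (exists t, w = ray j *+ t).
  exists t; split; last by rewrite zw wt.
  apply/nsumP => -[a [b [ka kb abt]]].
  have ab c : (c <= t)%N -> ray j *+ c \in box D b1.
    by move=> ct; apply: box_mulrn ct _; rewrite -wt.
  have at' : ray j *+ a \in box D b1 by apply: ab; rewrite -abt leq_addr.
  have bt' : ray j *+ b \in box D b1 by apply: ab; rewrite -abt leq_addl.
  have xL' : v j *+ n + ray j *+ a \in L n.
    by apply: inL1 => //; rewrite intvMn; exact: conicZ.
  have yL' : e *: (u j *+ n + ray j *+ b) \in L n.
    by apply: inL2 => //; rewrite intvMn; exact: conicZ.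
  case: (key _ _ xL' yL').
  - by rewrite zw wt addrACA -mulrnDl -mulrnDr abt.
  - by apply: nM1 => // s ks /(mulrn_vec_inj f0) as'; rewrite -as' ka in ks.
  - by apply: nM2 => // s ks /(mulrn_vec_inj f0) as'; rewrite -as' kb in ks.
(* Off the ray, z = n v_j + (n u_j + w) uses only kept points, since 0 belongs to [keep j]. *)
exfalso.
have xL' : v j *+ n + 0 \in L n by apply: inL1 => //; rewrite intv0; exact: conic0.
have yL' := inL2 j w wb wc.
case: (key _ _ xL' yL').
- by rewrite zw addr0 mulrnDl [RHS]addrA.
- apply: nM1 => // s ks E; case/negP: ks.
  by rewrite -(mulrn_vec_inj f0 (x1 := 0%N) (x2 := s)) //.
- by apply: nM2 => // s ks E; apply: now; exists s.
Qed.

Variables p q : 'I_m.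
Hypothesis keep_other : forall j, j != p -> j != q ->
  (forall t, keep j t) /\ (forall t, keep2 j t).
Hypothesis ray_p : ray p != 0.
Hypothesis ray_q : ray q != 0.
Hypothesis centers_neq : v p + u p != v q + u q.

Lemma card_missing_points : exists N : nat, forall n (S : {fset 'rV[int]_D}), (N <= n)%N ->
  (forall z, z \in S <-> exists j t,
     ~~ nsum (keep j) (keep2 j) t /\ z = (v j + u j) *+ n + ray j *+ t) ->
  #|` S| = (missing (keep p) (keep2 p) T + missing (keep q) (keep2 q) T)%N.
Proof.
have [b hb] := ray_box; exists (b + b).+1 => n S nb hS.
pose mt j := filter (fun t => ~~ nsum (keep j) (keep2 j) t) (iota 0 T).
pose I j := [fset (v j + u j) *+ n + ray j *+ t | t in mt j].
have lt_T j t : ~~ nsum (keep j) (keep2 j) t -> (t < T)%N.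
  move=> h; rewrite ltnNge; apply: contra h => Tt; apply/nsumP.
  by exists 0%N, t; rewrite keep0 keep_large.
have memI j z : z \in I j <-> exists t,
    ~~ nsum (keep j) (keep2 j) t /\ z = (v j + u j) *+ n + ray j *+ t.
  split=> [/imfsetP [t /=]|[t [jt ->]]].
    by rewrite mem_filter => /andP[jt _] ->; exists t.
  by apply/imfsetP; exists t => //=; rewrite mem_filter jt mem_iota (lt_T j).
have cI j : ray j != 0 -> #|` I j| = missing (keep j) (keep2 j) T.
  move=> f0; rewrite card_imfset /=; last by move=> t t' /addrI /(mulrn_vec_inj f0).
  by rewrite undup_id ?filter_uniq ?iota_uniq // size_filter.
have SE : S = I p `|` I q.
  apply/fsetP => z; rewrite in_fsetU; apply/idP/orP => [/hS [j [t [jt zE]]]|].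
    have [jp|jp] := eqVneq j p; first by left; apply/memI; exists t; rewrite -jp.
    have [jq|jq] := eqVneq j q; first by right; apply/memI; exists t; rewrite -jq.
    have [k1 k2] := keep_other jp jq.
    by case/negP: jt; apply/nsumP; exists 0%N, t; rewrite k1 k2.
  by case=> /memI [t [jt ->]]; apply/hS; [exists p, t|exists q, t].
have dis : I p `&` I q = fset0.
  apply/fsetP => z; rewrite in_fsetI in_fset0; apply/negP => /andP[].
  move=> /memI [t [/lt_T tT ->]] /memI [t' [/lt_T tT' E]].
  have /negP : ((v q + u q) - (v p + u p)) *+ n \notin box D (b + b).
    by apply: mulrn_not_box => //; rewrite subr_eq0 eq_sym.
  apply; suff -> : ((v q + u q) - (v p + u p)) *+ n = ray p *+ t - ray q *+ t'.
    by apply: boxD; [exact: hb|exact/boxN/hb].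
  by apply/eqP; rewrite mulrnBl subr_eq addrAC eq_sym subr_eq addrC E.
by rewrite SE cardfsU dis cardfs0 subn0 !cI.
Qed.

(** Outside the exceptional family of [few_bad_sets], every z with more than k0 representations is
    present, so the fringe alone determines the number of misses. *)
Lemma most_sets_miss c0 : (forall n, (#|` M n| <= c0)%N) ->
  exists N b0 : nat, forall n (U E : {fset 'rV[int]_D}), (N <= n)%N ->
  U `<=` L n -> E `<=` L n ->
  (forall x, x \in U `|` E -> x \notin M n) ->
  (forall x, x \in L n -> x \notin M n -> x \in U `|` E) ->
  (forall x, x \in L n -> x \notin M n -> (exists j, x - v j *+ n \in box D b0) -> x \in E) ->
  (#|` [fset A in fpowerset U | #|` gsum e (L n) `\` gsum e (A `|` E)| !=
      (missing (keep p) (keep2 p) T + missing (keep q) (keep2 q) T)%N]|)%:R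
    <= 4^-1 * 2 ^+ #|` U| :> R.
Proof.
move=> Mc.
have [k0 hk0] := few_bad_sets hL hLbox m1 v_inj ee tauK compat c0.
have [N1 [b0 hN1]] := missing_points k0.
have [N2 hN2] := card_missing_points.
exists (maxn N1 (maxn N2 1)), b0 => n U E; rewrite !geq_max => /andP[nN1 /andP[nN2 n0]].
move=> UL EL UEM LUE near_E.
apply: le_trans (hk0 n (M n) U E n0 (Mc n) LUE); rewrite ler_nat.
apply/fsubset_leq_card/fsubsetP => A.
rewrite !inE => /andP[AU bad]; rewrite AU /=; rewrite fpowersetE in AU.
apply/asboolP; apply: contrapT => nobad.
case/negP: bad; apply/eqP; apply: (hN2 n) => // z; apply: (hN1 n) => //.
- by rewrite fsubUset (fsubset_trans AU UL).
- by move=> x xA; apply: UEM; move: xA; rewrite !in_fsetU => /orP[/(fsubsetP AU) ->|->]; rewrite ?orbT.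
- by move=> x xL xM xn; rewrite in_fsetU near_E ?orbT.
move=> z' zL zk; apply: contrapT => /negP zA; apply: nobad.
by exists z'.
Qed.

End Fringe.

(** * A positive proportion of sets, for sums and differences at once *)

Section Sufficiency.
Local Open Scope fset_scope.
Local Open Scope ring_scope.
Variables (R : realType) (D m : nat) (L : nat -> {fset 'rV[int]_D}) (cb : nat).
Variables (v : 'I_m -> 'rV[int]_D) (tau : 'I_m -> 'I_m).
Local Notation iv := (@intv R D).
Local Notation rv := (fun i => iv (v i)).

Hypothesis hL : forall n z, (0 < n)%N -> (z \in L n) <-> hull rv n%:R (iv z).
Hypothesis hLbox : forall n z, z \in L n -> z \in box D (n * cb).
Hypothesis m1 : (1 < m)%N.
Hypothesis v_inj : injective v.
Hypothesis exposed : forall j, exists a, exposes rv a j.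
Hypothesis tauK : involutive tau.
Hypothesis tau_neq : forall j, tau j != j.
Hypothesis cone_sym : forall j z, conic rv j z <-> conic rv (tau j) (- z).

Lemma missingC (A B : pred nat) T : missing A B T = missing B A T.
Proof.
apply: eq_count => t; congr (~~ _).
by apply/nsumP/nsumP => -[i [j [Ai Bj <-]]]; exists j, i; rewrite addnC.
Qed.

Lemma cone_sum j x : conic rv j x <-> conic (fun i => iv (svert v id 1 i)) j x.
Proof.
have -> // : (fun i => iv (svert v id 1 i)) = rv.
by apply/funext => i; rewrite /svert scale1r.
Qed.

(** This is where the symmetry of the cones at paired vertices enters: u_j is -v_{tau j}, whose cone
    is the negative of the cone at [v (tau j)]. *)
Lemma cone_diff j x : conic rv j x <-> conic (fun i => iv (svert v tau (-1) i)) j x.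
Proof.
have E (c : 'I_m -> R) : \sum_i c i *: (iv (svert v tau (-1) i) - iv (svert v tau (-1) j)) =
    - \sum_i c (tau i) *: (rv i - rv (tau j)).
  rewrite (reindex_inj (inv_inj tauK)) -sumrN; apply: eq_bigr => i _.
  by rewrite /svert tauK !intvZ !scaleN1r opprK -scalerN opprB addrC.
rewrite cone_sym; split=> -[c [c0 cE]]; exists (c \o tau); split => //=.
  rewrite E -[x]opprK cE; congr (- _); apply: eq_bigr => i _ /=.
  by rewrite tauK.
by rewrite cE E opprK.
Qed.

Lemma card_near_vertices n b (E : {fset 'rV[int]_D}) :
  (forall x, x \in E -> exists j, x - v j *+ n \in box D b) ->
  (#|` E| <= m * (2 * b).+1 ^ D)%N.
Proof.
move=> h; pose F j := [fset v j *+ n + w | w in box D b].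
apply: leq_trans (_ : \sum_(j <- enum 'I_m) #|` F j| <= _)%N.
  apply: card_fset_union_bound => x /h [j xj]; exists j; first by rewrite mem_enum.
  by apply/imfsetP; exists (x - v j *+ n); rewrite //= addrC subrK.
have cF j : (#|` F j| <= (2 * b).+1 ^ D)%N.
  apply: leq_trans (leq_imfset_card _ _ _) _.
  by apply: leq_trans (size_undup _) _; rewrite size_box.
apply: leq_trans (leq_sum _ (fun j _ => cF j)) _.
by rewrite big_const_seq count_predT iter_addn_0 size_enum_ord mulnC.
Qed.

(** L(nP) splits into the omitted points M, the forced points E near vertices and the free points U.
    Sums and differences each go wrong for at most a quarter of the subsets of U, and |E| + |M| is
    bounded independently of n. *)
Lemma positive_proportion s d : exists2 c : R, 0 < c & exists N, forall n, (N <= n)%N ->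
  c * 2 ^+ #|` L n| <= (#|` [fset A in fpowerset (L n) |
     (#|` gsum 1 (L n) `\` gsum 1 A| == s) &&
     (#|` gsum (-1) (L n) `\` gsum (-1) A| == 2 * d)%N]|)%:R.
Proof.
have [T [A0 [B0 [[A00 B00] AB_large sE dE]]]] := exists_fringe_pair s d.
pose p : 'I_m := Ordinal (ltnW m1); pose q := tau p.
have qp : q != p := tau_neq p.
have [f [f0 fc face]] := exists_lattice_ray m1 v_inj (exposed p).
have tauq : tau q = p by exact: tauK.
clearbody p q => {qp}; have qp : q != p by rewrite -tauq eq_sym tau_neq.
have taup : tau p = q by rewrite -tauq tauK.
pose ray j := if j == p then f else if j == q then - f else 0.
pose keep j : pred nat := if j == p then A0 else if j == q then B0 else predT.
have rayp : ray p = f by rewrite /ray eqxx.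
have rayq : ray q = - f by rewrite /ray (negPf qp) eqxx.
have keepp : keep p = A0 by rewrite /keep eqxx.
have keepq : keep q = B0 by rewrite /keep (negPf qp) eqxx.
have rayo j : j != p -> j != q -> ray j = 0 by rewrite /ray => /negPf -> /negPf ->.
have keepo j : j != p -> j != q -> forall t, keep j t.
  by rewrite /keep => /negPf -> /negPf ->.
clearbody ray keep.
have cases j : [\/ j = p, j = q | j != p /\ j != q].
  have [->|jp] := eqVneq j p; first by constructor 1.
  by have [->|jq] := eqVneq j q; [constructor 2|constructor 3].
have tauo j : j != p -> j != q -> tau j != p /\ tau j != q.
  move=> jp jq; split; first by rewrite -tauq (inj_eq (inv_inj tauK)).
  by rewrite -taup (inj_eq (inv_inj tauK)).
have keep0 j : keep j 0%N.
  by case: (cases j) => [->|->|[jp jq]]; rewrite ?keepp ?keepq ?keepo.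
have keep_large j t : (T <= t)%N -> keep j t.
  move=> /AB_large [At Bt].
  by case: (cases j) => [->|->|[jp jq]]; rewrite ?keepp ?keepq ?keepo.
pose extremal j := [/\ ray j != 0, conic rv j (iv (ray j)) &
  forall (x y : 'rV[int]_D) t, conic rv j (iv x) -> conic rv j (iv y) ->
    x + y = ray j *+ t -> exists k, x = ray j *+ k].
have extreme j : (j != p /\ j != q) \/ extremal j.
  case: (cases j) => [->|->|]; [right|right|by left].
    by rewrite /extremal rayp; split.
  rewrite /extremal rayq; split; first by rewrite oppr_eq0.
    by rewrite intvN cone_sym opprK tauq.
  move=> x y t; rewrite !(cone_sym q) tauq -!intvN => xc yc xy.
  have [|k xk] := face _ _ t xc yc.
    by rewrite -opprD xy mulNrn opprK.
  by exists k; rewrite mulNrn -xk opprK.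
pose Mj n j := [fset v j *+ n + ray j *+ t | t in filter (fun t => ~~ keep j t) (iota 0 T)].
pose M n := Mj n p `|` Mj n q.
have memMj n j x : x \in Mj n j <-> exists t, ~~ keep j t /\ x = v j *+ n + ray j *+ t.
  split=> [/imfsetP [t /=]|[t [jt ->]]].
    by rewrite mem_filter => /andP[jt _] ->; exists t.
  apply/imfsetP; exists t => //=; rewrite mem_filter jt mem_iota /= add0n ltnNge.
  by apply: contra jt => /(keep_large j).
have memM n x : (x \in M n) <-> exists j t, ~~ keep j t /\ x = v j *+ n + ray j *+ t.
  rewrite in_fsetU; split=> [/orP[]/memMj [t h]|[j [t [jt xE]]]].
  - by exists p, t.
  - by exists q, t.
  apply/orP; case: (cases j) => [jp|jq|[jp jq]].
  - by left; apply/memMj; exists t; rewrite -jp.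
  - by right; apply/memMj; exists t; rewrite -jq.
  - by rewrite keepo in jt.
have cardM n : (#|` M n| <= T + T)%N.
  apply: leq_trans (card_fsetU_le _ _) _.
  by apply: leq_add; apply: leq_trans (leq_imfset_card _ _ _) _;
    apply: leq_trans (size_undup _) _; rewrite size_filter -{2}(size_iota 0 T) count_size.
have vpq : v p != v q by rewrite (inj_eq v_inj) eq_sym.
have rp0 : ray p != 0 by rewrite rayp.
have rq0 : ray q != 0 by rewrite rayq oppr_eq0.
have [N1 [b1 h1]] : exists N b0 : nat, forall n (U E : {fset 'rV[int]_D}), (N <= n)%N ->
  U `<=` L n -> E `<=` L n ->
  (forall x, x \in U `|` E -> x \notin M n) ->
  (forall x, x \in L n -> x \notin M n -> x \in U `|` E) ->
  (forall x, x \in L n -> x \notin M n -> (exists j, x - v j *+ n \in box D b0) -> x \in E) ->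
  (#|` [fset A in fpowerset U | #|` gsum 1 (L n) `\` gsum 1 (A `|` E)| !=
      (missing (keep p) (keep p) T + missing (keep q) (keep q) T)%N]|)%:R
    <= 4^-1 * 2 ^+ #|` U| :> R.
  have rt j : (1 : int) *: ray j = ray (id j) by rewrite scale1r.
  have ex j : ((forall t, keep j t) /\ (forall t, keep (id j) t)) \/ extremal j.
    case: (extreme j) => [[jp jq]|]; last by right.
    by left; split; exact: keepo.
  have ot j : j != p -> j != q -> (forall t, keep j t) /\ (forall t, keep (id j) t).
    by move=> jp jq; split; exact: keepo.
  have cn : v p + svert v id 1 p != v q + svert v id 1 q.
    rewrite /svert !scale1r -!mulr2n; apply: contraNneq vpq => h.
    apply/eqP; apply/rowP => i; have := congr1 (fun x : 'rV_D => x ord0 i) h.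
    by rewrite !mulmxnE !ord1; move: (v p _ _) (v q _ _) => a b; lia.
  exact: (most_sets_miss hL hLbox m1 v_inj (mul1r 1) (frefl id) cone_sum rt keep0
    keep_large ex memM ot rp0 rq0 cn cardM).
have [N2 [b2 h2]] : exists N b0 : nat, forall n (U E : {fset 'rV[int]_D}), (N <= n)%N ->
  U `<=` L n -> E `<=` L n ->
  (forall x, x \in U `|` E -> x \notin M n) ->
  (forall x, x \in L n -> x \notin M n -> x \in U `|` E) ->
  (forall x, x \in L n -> x \notin M n -> (exists j, x - v j *+ n \in box D b0) -> x \in E) ->
  (#|` [fset A in fpowerset U | #|` gsum (-1) (L n) `\` gsum (-1) (A `|` E)| !=
      (missing (keep p) (keep (tau p)) T + missing (keep q) (keep (tau q)) T)%N]|)%:R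
    <= 4^-1 * 2 ^+ #|` U| :> R.
  have rt j : (-1 : int) *: ray j = ray (tau j).
    rewrite scaleN1r; case: (cases j) => [->|->|[jp jq]].
    + by rewrite taup rayp rayq.
    + by rewrite tauq rayp rayq opprK.
    + by have [tp tq] := tauo j jp jq; rewrite !rayo ?oppr0.
  have ex j : ((forall t, keep j t) /\ (forall t, keep (tau j) t)) \/ extremal j.
    case: (extreme j) => [[jp jq]|]; last by right.
    by left; have [tp tq] := tauo j jp jq; split; exact: keepo.
  have ot j : j != p -> j != q -> (forall t, keep j t) /\ (forall t, keep (tau j) t).
    by move=> jp jq; have [tp tq] := tauo j jp jq; split; exact: keepo.
  have cn : v p + svert v tau (-1) p != v q + svert v tau (-1) q.
    rewrite /svert taup tauq !scaleN1r; apply: contraNneq vpq => h.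
    apply/eqP; apply/rowP => i; have := congr1 (fun x : 'rV_D => x ord0 i) h.
    by rewrite !mxE !ord1; move: (v p _ _) (v q _ _) => a b; lia.
  have ee : (-1 : int) * -1 = 1 by rewrite mulrNN mulr1.
  exact: (most_sets_miss hL hLbox m1 v_inj ee tauK cone_diff rt keep0
    keep_large ex memM ot rp0 rq0 cn cardM).
(* The sums lose the gaps of A0 + A0 at 2n v_p and those of B0 + B0 at 2n v_q, together s. *)
rewrite keepp keepq sE in h1.
(* The differences lose the d gaps of A0 + B0 at n(v_p - v_q) and again at n(v_q - v_p). *)
rewrite taup tauq keepp keepq (missingC B0) dE addnn -mul2n in h2.
(* [e0] bounds |E| by m boxes of radius b0, and |M| by T at each of p and q. *)
pose b0 := maxn b1 b2; pose e0 := (m * (2 * b0).+1 ^ D + (T + T))%N.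
exists (2 * 2 ^+ e0)^-1; first by rewrite invr_gt0 mulr_gt0 // exprn_gt0.
exists (maxn N1 N2) => n; rewrite geq_max => /andP[nN1 nN2].
pose near_v (x : 'rV[int]_D) := has (fun j => x - v j *+ n \in box D b0) (enum 'I_m).
pose E := [fset x in L n | near_v x && (x \notin M n)].
pose U := [fset x in L n | ~~ near_v x && (x \notin M n)].
have memE x : (x \in E) = [&& x \in L n, near_v x & x \notin M n] by rewrite !inE.
have memU x : (x \in U) = [&& x \in L n, ~~ near_v x & x \notin M n] by rewrite !inE.
have UL : U `<=` L n by apply/fsubsetP => x; rewrite memU => /and3P[].
have EL : E `<=` L n by apply/fsubsetP => x; rewrite memE => /and3P[].
have UEM x : x \in U `|` E -> x \notin M n.
  by rewrite in_fsetU memE memU => /orP[]/and3P[].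
have LUE x : x \in L n -> x \notin M n -> x \in U `|` E.
  by move=> xL xM; rewrite in_fsetU memE memU xL xM !andbT /= orNb.
have nE b x : (b <= b0)%N -> x \in L n -> x \notin M n ->
    (exists j, x - v j *+ n \in box D b) -> x \in E.
  move=> bb xL xM [j xj]; rewrite memE xL xM andbT; apply/hasP; exists j.
    by rewrite mem_enum.
  exact: box_leq xj.
have g1 := h1 n U E nN1 UL EL UEM LUE (fun x xL xM => nE b1 x (leq_maxl _ _) xL xM).
have g2 := h2 n U E nN2 UL EL UEM LUE (fun x xL xM => nE b2 x (leq_maxr _ _) xL xM).
move: g1 g2; set G1 := [fset A in _ | _]; set G2 := [fset A in _ | _] => g1 g2.
set G := [fset A in _ | _].
have cG : (2 ^ #|` U| <= #|` G| + (#|` G1| + #|` G2|))%N.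
  (* E and U are disjoint, so A is recovered from its union with E. *)
  have inj : {in fpowerset U `\` (G1 `|` G2) &, injective (fun A => A `|` E)}.
    have dE' A : A \in fpowerset U `\` (G1 `|` G2) -> A = (A `|` E) `\` E.
      rewrite in_fsetD fpowersetE => /andP[_ AU]; apply/fsetP => x.
      rewrite in_fsetD in_fsetU; have [xE|xE] := boolP (x \in E); rewrite ?orbF //=.
      apply/negP => /(fsubsetP AU); move: xE; rewrite memE memU.
      by case/and3P => _ -> _; rewrite andbF.
    move=> A A' hA hA' /= AA'.
    by rewrite [LHS](dE' _ hA) [RHS](dE' _ hA') AA'.
  rewrite -card_fpowerset -(cardfsID (G1 `|` G2) (fpowerset U)) addnC.
  apply: leq_add; last first.
    apply: leq_trans (card_fsetU_le _ _).
    by apply/fsubset_leq_card/fsubsetIr.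
  rewrite -(card_in_imfset imfset_key inj); apply/fsubset_leq_card/fsubsetP.
  move=> _ /imfsetP [A /= + ->]; rewrite in_fsetD in_fsetU negb_or.
  move=> /andP[/andP[A1 A2] AU].
  have [e1 e2] : #|` gsum 1 (L n) `\` gsum 1 (A `|` E)| = s /\
     #|` gsum (-1) (L n) `\` gsum (-1) (A `|` E)| = (2 * d)%N.
    by move: A1 A2; rewrite !inE AU /= !negbK => /eqP -> /eqP ->.
  rewrite !inE e1 e2 !eqxx !andbT fpowersetE fsubUset EL andbT.
  by apply: fsubset_trans UL; rewrite -fpowersetE.
have cL : (#|` L n| <= #|` U| + e0)%N.
  apply: leq_trans (_ : #|` U `|` (E `|` M n)| <= _)%N.
    apply/fsubset_leq_card/fsubsetP => x xL; rewrite fsetUA in_fsetU.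
    by have [|xM] := boolP (x \in M n); [rewrite orbT|rewrite LUE].
  apply: leq_trans (card_fsetU_le _ _) _; rewrite leq_add2l.
  apply: leq_trans (card_fsetU_le _ _) _; apply: leq_add => //.
  apply: (@card_near_vertices n) => x; rewrite memE => /and3P[_ /hasP [j _ xj] _].
  by exists j.
have c1 : 2 ^+ #|` L n| <= 2 ^+ #|` U| * 2 ^+ e0 :> R.
  by rewrite -exprD -!natrX ler_nat leq_exp2l.
have c2 : 2 ^+ #|` U| <= #|` G|%:R + (#|` G1|%:R + #|` G2|%:R) :> R.
  by rewrite -!natrD -natrX ler_nat.
have e00 : 0 < 2 ^+ e0 :> R by rewrite exprn_gt0.
have c3 : 2 ^+ #|` U| <= #|` G|%:R * 2 :> R.
  move: c2 g1 g2; clear.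
  move: (2 ^+ _) (#|` G|%:R) (#|` G1|%:R) (#|` G2|%:R) => w x y z; lra.
rewrite mulrC ler_pdivrMr ?mulr_gt0 //; apply: le_trans c1 _.
by rewrite mulrA; apply: ler_wpM2r c3; exact: ltW.
Qed.

End Sufficiency.

(** * Assembly of the equivalence *)

Lemma symmetric_property_a (R : realType) (D m : nat) (V : seq 'rV[int]_D)
    (v : 'I_m -> 'rV[int]_D) s d :
  (1 < m)%N -> injective v ->
  (forall x : 'rV[R]_D, polytope V x <-> hull (fun i => intv R (v i)) 1 x) ->
  (forall j, exists a : 'rV[R]_D, exposes (fun i => intv R (v i)) a j) ->
  locally_point_symmetric (@polytope R D V) -> property_a R V s d.
Proof.
move=> m1 vi hV hexp [sigma hs].
have vertP := is_vertexP hV m1 hexp.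
have rvi i j : intv R (v i) = intv R (v j) -> i = j by move=> /intv_inj /vi.
have vert j : is_vertex (@polytope R D V) (intv R (v j)) by apply/vertP; exists j.
have htau j : exists k, sigma (intv R (v j)) = intv R (v k).
  by have [/vertP] := hs _ (vert j).
have [tau tauE] := choice htau.
have tauK : involutive tau.
  by move=> j; apply: rvi; rewrite -!tauE; have [] := hs _ (vert j).
have tau_neq j : tau j != j.
  by have [_ + _ _ _] := hs _ (vert j); rewrite tauE; apply: contraNneq => ->.
have csym j z : conic (fun i => intv R (v i)) j z <->
    conic (fun i => intv R (v i)) (tau j) (- z).
  have [_ _ _ _] := hs _ (vert j); rewrite tauE.
  by move=> /(cone_symmetricP hV j (tau j)) /(_ z).
have mL n z : (0 < n)%N -> (z \in Lpts R V n) <-> hull (fun i => intv R (v i)) n%:R (intv R z).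
  exact: mem_Lpts_hull hV n z.
have bL n z : z \in Lpts R V n -> z \in box D (n * coord_bound V).
  by rewrite !inE => /andP[].
have [c c0 [N hN]] := positive_proportion mL bL m1 vi hexp tauK tau_neq csym s d.
exists c; split => //; exists N => n /hN.
have sE A : sumset A A = gsum 1 A.
  apply/fsetP => z; apply/imfset2P/gsumP => // [[x /= xA [y /= yA ->]]|[x [y [xA yA ->]]]].
    by exists x, y; rewrite scale1r.
  by exists x => //; exists y => //=; rewrite scale1r in yA.
have dE A : diffset A A = gsum (-1) A.
  apply/fsetP => z; apply/diffsetP/gsumP => // [[x [y [xA yA ->]]]|[x [y [xA yA ->]]]].
    by exists x, (- y); rewrite scaleN1r opprK.
  by exists x, (- y); rewrite -scaleN1r yA scaleN1r opprK.
move/le_trans; apply; rewrite ler_nat /count_good.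
apply/fsubset_leq_card/fsubsetP => A; rewrite !inE => /andP[-> /andP[h1 h2]] /=.
by rewrite !sE !dE h1.
Qed.

(** Two distinct generators exclude the single point, which has no antipodal pair although A = L(nP)
    misses nothing there. *)
Theorem theorem1 (R : realType) (D : nat) (V : seq 'rV[int]_D) (s d : nat) :
  (exists v1 v2, v1 \in V /\ v2 \in V /\ v1 != v2) ->
  (@property_a R D V s d <-> locally_point_symmetric (@polytope R D V)).
Proof.
move=> /(@polytope_vertex_system R) [m [v [v_inj m1 hV hexp]]].
split; first exact: property_a_symmetric m1 v_inj hV hexp.
exact: symmetric_property_a m1 v_inj hV hexp.
Qed.
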